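(* Let $i\in\mathbb{N}_0$ and let $\alpha,\beta,\epsilon\in\mathbb{C}$. Then $$F^{0:2;2}_{1:0;0}\left[\begin{matrix}-: & \alpha,\ \epsilon\,; & \beta-\epsilon,\ \beta+\epsilon-\alpha-i-1\,;\\ \beta: & -\,; & -\,;\end{matrix}\ -1,\ \tfrac12\right] =\frac{2^{\beta+\epsilon-\alpha-i-2}\,\Gamma(1-\epsilon)\,\Gamma(\beta)}{\Gamma(1-\epsilon+i)\,\Gamma(\beta+\epsilon-i-1)}\sum_{r=0}^{i}(-1)^r\binom{i}{r}\frac{\Gamma\!\left(\frac{\beta+\epsilon-i+r-1}{2}\right)}{\Gamma\!\left(\frac{\beta-\epsilon-i+r+1}{2}\right)}$$ and $$F^{0:2;2}_{1:0;0}\left[\begin{matrix}-: & \alpha,\ \epsilon\,; & \beta-\epsilon,\ \beta+\epsilon-\alpha+i-1\,;\\ \beta: & -\,; & -\,;\end{matrix}\ -1,\ \tfrac12\right] =\frac{2^{\beta+\epsilon-\alpha+i-2}\,\Gamma(\beta)}{\Gamma(\beta+\epsilon+i-1)}\sum_{r=0}^{i}\binom{i}{r}\frac{\Gamma\!\left(\frac{\beta+\epsilon+i+r-1}{2}\right)}{\Gamma\!\left(\frac{\beta-\epsilon-i+r+1}{2}\right)}.$$ (The left-hand sides are Appell $F_3$ series.)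
   Context: For $\lambda\in\mathbb{C}$ and $n\in\mathbb{N}_0$, $(\lambda)_0=1$ and $(\lambda)_n=\lambda(\lambda+1)\cdots(\lambda+n-1)$; $\Gamma$ is Euler's Gamma function and $\binom{i}{r}$ the binomial coefficient. The (generalized) Kampé de Fériet function is defined by $$F^{H:A;B}_{G:C;D}\left[\begin{matrix}(h_H): & (a_A)\,; & (b_B)\,;\\ (g_G): & (c_C)\,; & (d_D)\,;\end{matrix}\ x,\ y\right]=\sum_{m=0}^\infty\sum_{n=0}^\infty\frac{\prod_{j=1}^H(h_j)_{m+n}\prod_{j=1}^A(a_j)_m\prod_{j=1}^B(b_j)_n}{\prod_{j=1}^G(g_j)_{m+n}\prod_{j=1}^C(c_j)_m\prod_{j=1}^D(d_j)_n}\frac{x^m}{m!}\frac{y^n}{n!},$$ where a dash ''$-$'' denotes an empty list of parameters (empty products equal $1$). In particular $F^{0:2;2}_{1:0;0}[-:\alpha,\epsilon;\beta-\epsilon,\gamma;\ \beta:-;-;\ x,y]=\sum_{m,n\ge0}\frac{(\alpha)_m(\epsilon)_m(\beta-\epsilon)_n(\gamma)_n}{(\beta)_{m+n}}\frac{x^my^n}{m!\,n!}$ (Appell's $F_3$). Parameters are tacitly assumed to be such that the double series converges, no denominator parameter is a non-positive integer, and all Gamma values appearing are finite. *)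

(* Defs.v *)
From Stdlib Require Import Reals Factorial.
From Coquelicot Require Import Coquelicot.
Open Scope C_scope.

Fixpoint poch (z : C) (n : nat) : C :=
  match n with
  | O => 1
  | S k => poch z k * (z + RtoC (INR k))
  end.

Definition cexp (z : C) : C :=
  (exp (Re z) * cos (Im z), exp (Re z) * sin (Im z))%R.
Definition cpowR (a : R) (w : C) : C := cexp (w * RtoC (ln a)).

(* Euler's Gamma function on C via Gauss' product formula
   Gamma z = lim_{n -> oo} n! n^z / (z (z+1) ... (z+n)),
   valid for every z which is not a non-positive integer. *)
Definition gauss_seq (z : C) (n : nat) : C :=
  RtoC (INR (fact n)) * cpowR (INR n) z / poch z (S n).
Definition Gamma (z : C) : C :=
  (real (Lim_seq (fun n => Re (gauss_seq z n))),
   real (Lim_seq (fun n => Im (gauss_seq z n)))).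

Definition nonpos_int (z : C) : Prop := exists k : nat, z = RtoC (- INR k).

Fixpoint csum (n : nat) (f : nat -> C) : C :=
  match n with
  | O => 0
  | S k => csum k f + f k
  end.

(* General term of F^{0:2;2}_{1:0;0}[-: a1,a2; b1,b2; g: -; -; x, y] (Appell F3). *)
Definition F3_term (a1 a2 b1 b2 g x y : C) (m n : nat) : C :=
  poch a1 m * poch a2 m * poch b1 n * poch b2 n / poch g (m + n)
  * (x ^ m / RtoC (INR (fact m))) * (y ^ n / RtoC (INR (fact n))).

(* Convergence of a double series (Pringsheim sense): the rectangular partial
   sums  sum_{m<M} sum_{n<N} t m n  tend to L as M, N -> oo independently. *)
Definition double_series_converges_to (t : nat -> nat -> C) (L : C) : Prop :=
  forall eps : R, (0 < eps)%R ->
    exists K : nat, forall M N : nat, (K <= M)%nat -> (K <= N)%nat ->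
      (Cmod (csum M (fun m => csum N (fun n => t m n)) - L) < eps)%R.

(* Main.v *)
Require Import Defs.
From Stdlib Require Import Reals Factorial Lra Lia Classical.
From Coquelicot Require Import Coquelicot.
Open Scope C_scope.

(** Pringsheim convergence makes the iterated series, rows first, converge to the same value.
    Its rows are [(-1)^m (alpha)_m / m!] times a sequence whose iterated differences are explicit,
    because [(e)_m (b-e)_n / (b)_(m+n)] reproduces itself under differences.  Euler's summation
    method, which is regular, together with Cauchy products therefore gives, without any condition
    beyond convergence, [2^(-alpha) 2F1(beta-eps, alpha+gamma; beta; 1/2)], and Euler's
    transformation turns this into [2F1(eps, 1-eps+i; beta; 1/2)] or [2F1(eps, 1-eps-i; beta; 1/2)]
    up to a power of 2.

    The latter are reduced to [i = 0] by contiguity relations, the binomial sums of the theorem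
    being the iterated form of a two-term relation.  The case [i = 0] is Bailey's theorem: the value
    satisfies a first-order recurrence in [c -> c + 2] and tends to 1 as [c] grows, so it is
    evaluated by Gauss' product formula.  All this is done for series divided by [Gamma c], since
    the contiguity relations pass through values of [c] that may be non-positive integers. *)

(** * Limits and series of complex numbers *)

(** At [x = -1] the outer sum may converge only conditionally, and Pringsheim convergence controls
    rectangles alone, so the double series cannot be rearranged directly. Euler's method replaces
    the alternating outer sum by one whose terms decay geometrically; only then are sums
    interchanged. Both factors of a row, [(al)_m / m!] and the Beta-type weight, are formally
    moments of [t^m] for a Beta density. A difference in [m] multiplies by [1 - t] and stays in the
    same family. By the Leibniz rule the transformed series is half the product of the binomial
    series of [(1 - x)^(al - 1)] at [1/2], which is [2^(1 - al)], and a series for the [2F1]. All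
    majorants are geometric. The constant [5/4] bounds [|a + n| / |c + n|] for large [n]; its cube
    is below 2, so even three such factors are beaten by [(1/2)^n]. *)

Definition clim (u : nat -> C) (l : C) : Prop :=
  is_lim_seq (fun n => Re (u n)) (Re l) /\ is_lim_seq (fun n => Im (u n)) (Im l).

Definition has_sum (f : nat -> C) (l : C) : Prop := clim (fun n => csum n f) l.

(** A total function, so that sums can be written as terms; it is meaningful only where a matching
    [has_sum] is available. *)
Definition cseries (f : nat -> C) : C :=
  (real (Lim_seq (fun n => Re (csum n f))), real (Lim_seq (fun n => Im (csum n f)))).

Lemma im_le_Cmod (z : C) : (Rabs (Im z) <= Cmod z)%R.
Proof.
  eapply Rle_trans; [apply (Rmax_r (Rabs (fst z))) | apply Rmax_Cmod].
Qed.

Lemma Cmod_le_abs (z : C) : (Cmod z <= Rabs (Re z) + Rabs (Im z))%R.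
Proof.
  replace z with (RtoC (Re z) + Ci * RtoC (Im z)) at 1.
  - eapply Rle_trans; [apply Cmod_triangle|].
    rewrite Cmod_mult, Cmod_Ci, !Cmod_R. lra.
  - destruct z; unfold Ci, RtoC, Cplus, Cmult, Re, Im; simpl; f_equal; ring.
Qed.

Lemma Cmod_sub_sym (x y : C) : Cmod (x - y) = Cmod (y - x).
Proof. rewrite <- Cmod_opp. f_equal. ring. Qed.

Lemma Cmod_sub_triangle (x y z : C) : (Cmod (x - z) <= Cmod (x - y) + Cmod (y - z))%R.
Proof. replace (x - z) with ((x - y) + (y - z)) by ring. apply Cmod_triangle. Qed.

Lemma Cmod_INR (n : nat) : Cmod (RtoC (INR n)) = INR n.
Proof. rewrite Cmod_R. apply Rabs_pos_eq, pos_INR. Qed.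

Lemma re_minus (a b : C) : Re (a - b) = (Re a - Re b)%R.
Proof. unfold Cminus. rewrite re_plus, re_opp. ring. Qed.

Lemma im_minus (a b : C) : Im (a - b) = (Im a - Im b)%R.
Proof. unfold Cminus. rewrite im_plus, im_opp. ring. Qed.

Lemma is_lim_seq_dist (u : nat -> R) (l : R) :
  is_lim_seq u l <-> is_lim_seq (fun n => Rabs (u n - l)) 0.
Proof.
  split; intros H.
  - apply (is_lim_seq_abs_0 (fun n => u n - l)%R).
    replace (Finite 0) with (Finite (l - l)) by (f_equal; ring).
    apply is_lim_seq_minus'; [exact H | apply is_lim_seq_const].
  - apply (is_lim_seq_abs_0 (fun n => u n - l)%R) in H.
    apply is_lim_seq_ext with (fun n => (u n - l) + l)%R; [intros; ring|].
    replace (Finite l) with (Finite (0 + l)) by (f_equal; ring).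
    apply is_lim_seq_plus'; [exact H | apply is_lim_seq_const].
Qed.

Lemma is_lim_seq_0_le (u v : nat -> R) :
  (forall n, 0 <= u n <= v n)%R -> is_lim_seq v 0 -> is_lim_seq u 0.
Proof.
  intros H Hv. apply is_lim_seq_le_le with (fun _ => 0%R) v; auto.
  apply is_lim_seq_const.
Qed.

Lemma clim_Cmod (u : nat -> C) (l : C) :
  clim u l <-> is_lim_seq (fun n => Cmod (u n - l)) 0.
Proof.
  unfold clim. rewrite (is_lim_seq_dist (fun n => Re (u n))), (is_lim_seq_dist (fun n => Im (u n))).
  split.
  - intros [H1 H2].
    apply is_lim_seq_0_le with (fun n => (Rabs (Re (u n) - Re l) + Rabs (Im (u n) - Im l))%R).
    + intros n. split; [apply Cmod_ge_0|].
      rewrite <- re_minus, <- im_minus. apply Cmod_le_abs.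
    + replace (Finite 0) with (Finite (0 + 0)) by (f_equal; ring).
      now apply is_lim_seq_plus'.
  - intros H; split; (eapply is_lim_seq_0_le; [|exact H]); intros n;
      (split; [apply Rabs_pos|]).
    + rewrite <- re_minus. apply re_le_Cmod.
    + rewrite <- im_minus. apply im_le_Cmod.
Qed.

Lemma clim_eps (u : nat -> C) (l : C) :
  clim u l <-> forall eps : R, (0 < eps)%R ->
    exists N, forall n, (N <= n)%nat -> (Cmod (u n - l) < eps)%R.
Proof.
  rewrite clim_Cmod, is_lim_seq_Reals. unfold Un_cv, Rdist. split; intros H eps He.
  - destruct (H eps He) as [N HN]. exists N. intros n Hn.
    specialize (HN n Hn). rewrite Rminus_0_r, Rabs_pos_eq in HN; auto using Cmod_ge_0.
  - destruct (H eps He) as [N HN]. exists N. intros n Hn.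
    rewrite Rminus_0_r, Rabs_pos_eq; auto using Cmod_ge_0.
Qed.

Lemma clim_unique (u : nat -> C) (l1 l2 : C) : clim u l1 -> clim u l2 -> l1 = l2.
Proof.
  intros [H1 H2] [H3 H4].
  apply is_lim_seq_unique in H1, H2, H3, H4.
  destruct l1, l2. unfold Re, Im in *; simpl in *. congruence.
Qed.

Lemma clim_ext (u v : nat -> C) (l : C) : (forall n, u n = v n) -> clim u l -> clim v l.
Proof.
  intros H [H1 H2]; split; (eapply is_lim_seq_ext; [|eassumption]);
    intros n; simpl; now rewrite H.
Qed.

Lemma clim_const (l : C) : clim (fun _ => l) l.
Proof. split; apply is_lim_seq_const. Qed.

Lemma clim_plus (u v : nat -> C) (a b : C) :
  clim u a -> clim v b -> clim (fun n => u n + v n) (a + b).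
Proof.
  intros [H1 H2] [H3 H4]; split.
  - rewrite re_plus. eapply is_lim_seq_ext; [intros n; symmetry; apply re_plus|].
    now apply is_lim_seq_plus'.
  - rewrite im_plus. eapply is_lim_seq_ext; [intros n; symmetry; apply im_plus|].
    now apply is_lim_seq_plus'.
Qed.

Lemma clim_mult (u v : nat -> C) (a b : C) :
  clim u a -> clim v b -> clim (fun n => u n * v n) (a * b).
Proof.
  intros [H1 H2] [H3 H4]; split.
  - rewrite re_mult. eapply is_lim_seq_ext; [intros n; symmetry; apply re_mult|].
    apply is_lim_seq_minus'; now apply is_lim_seq_mult'.
  - rewrite im_mult. eapply is_lim_seq_ext; [intros n; symmetry; apply im_mult|].
    apply is_lim_seq_plus'; now apply is_lim_seq_mult'.
Qed.

Lemma clim_scal (k : C) (u : nat -> C) (a : C) : clim u a -> clim (fun n => k * u n) (k * a).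
Proof. intros H. apply clim_mult; [apply clim_const | exact H]. Qed.

Lemma clim_minus (u v : nat -> C) (a b : C) :
  clim u a -> clim v b -> clim (fun n => u n - v n) (a - b).
Proof.
  intros Hu Hv.
  apply clim_ext with (fun n => u n + (-1) * v n); [intros; ring|].
  replace (a - b) with (a + (-1) * b) by ring.
  apply clim_plus; auto using clim_scal.
Qed.

Lemma clim_inv (u : nat -> C) (a : C) : a <> 0 -> clim u a -> clim (fun n => / u n) (/ a).
Proof.
  intros Ha [H1 H2].
  assert (Hd : (fst a ^ 2 + snd a ^ 2 <> 0)%R).
  { intros E. apply Ha. apply Cmod_eq_0.
    assert (K := Cmod2_alt a). unfold Re, Im in K. rewrite E in K.
    apply Rsqr_0_uniq. unfold Rsqr. simpl in K. rewrite Rmult_1_r in K. exact K. }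
  assert (Hl : is_lim_seq (fun n => Re (u n) ^ 2 + Im (u n) ^ 2)%R (Finite (Re a ^ 2 + Im a ^ 2))).
  { apply is_lim_seq_plus'; simpl; repeat apply is_lim_seq_mult';
      auto; apply is_lim_seq_const. }
  split; unfold Re, Im, Cinv in *; simpl in *.
  - apply is_lim_seq_div'; auto.
  - apply is_lim_seq_div'; auto.
    apply (proj1 (is_lim_seq_opp (fun n => snd (u n)) (Finite (snd a)))); auto.
Qed.

Lemma clim_incr_1 (u : nat -> C) (l : C) : clim (fun n => u (S n)) l <-> clim u l.
Proof.
  unfold clim.
  rewrite <- (is_lim_seq_incr_1 (fun n => Re (u n))), <- (is_lim_seq_incr_1 (fun n => Im (u n))).
  reflexivity.
Qed.

Lemma clim_double (u : nat -> C) (l : C) : clim u l -> clim (fun n => u (2 * n)%nat) l.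
Proof.
  rewrite !clim_eps. intros H eps He. destruct (H eps He) as [N HN].
  exists N. intros n Hn. apply HN. lia.
Qed.

Lemma clim_le (u : nat -> C) (l : C) (v : nat -> R) :
  (forall n, (Cmod (u n - l) <= v n)%R) -> is_lim_seq v 0 -> clim u l.
Proof.
  intros H Hv. apply clim_Cmod. apply is_lim_seq_0_le with v; auto.
  intros n; split; auto using Cmod_ge_0.
Qed.

Lemma clim_zero_le (u v : nat -> C) (l : C) (e : nat -> R) :
  (forall n, (Cmod (u n - v n) <= e n)%R) -> is_lim_seq e 0 -> clim v l -> clim u l.
Proof.
  intros H He Hv. apply clim_ext with (fun n => (u n - v n) + v n); [intros; ring|].
  replace l with (0 + l) by ring. apply clim_plus; auto.
  apply clim_le with e; auto. intros n.
  replace (u n - v n - 0) with (u n - v n) by ring. auto.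
Qed.

Lemma Cmod_lim_le (u : nat -> C) (l z : C) (M : R) (N : nat) :
  clim u l -> (forall n, (N <= n)%nat -> (Cmod (u n - z) <= M)%R) -> (Cmod (l - z) <= M)%R.
Proof.
  intros H HM. apply Rnot_lt_le. intros Hlt.
  destruct (proj1 (clim_eps u l) H (Cmod (l - z) - M)%R) as [K HK]; [lra|].
  specialize (HK (max N K) (Nat.le_max_r _ _)).
  specialize (HM (max N K) (Nat.le_max_l _ _)).
  assert (T := Cmod_sub_triangle l (u (max N K)) z).
  rewrite Cmod_sub_sym in HK. lra.
Qed.

Lemma clim_cauchy (u : nat -> C) (v : nat -> R) :
  (forall n k, (Cmod (u (n + k)%nat - u n) <= v n)%R) -> is_lim_seq v 0 ->
  exists l, clim u l.
Proof.
  intros H Hv.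
  (* [p] stands for [Re] and [Im], both 1-Lipschitz for the modulus; completeness of the reals is
     used on each component. *)
  assert (HC : forall p : C -> R, (forall a b, (Rabs (p a - p b) <= Cmod (a - b))%R) ->
             ex_finite_lim_seq (fun n => p (u n))).
  { intros p Hp. apply ex_lim_seq_cauchy_corr. intros eps.
    apply is_lim_seq_Reals in Hv.
    destruct (Hv (eps / 2)%R) as [N HN]; [destruct eps; simpl; lra|].
    exists N. intros n m Hn Hm.
    assert (HNN := HN N (le_n _)). unfold Rdist in HNN. rewrite Rminus_0_r in HNN.
    assert (Hv' : (v N < eps / 2)%R) by (eapply Rle_lt_trans; [apply Rle_abs | exact HNN]).
    eapply Rle_lt_trans; [apply Hp|].
    assert (T := Cmod_sub_triangle (u n) (u N) (u m)).
    assert (A := H N (n - N)%nat). assert (B := H N (m - N)%nat).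
    replace (N + (n - N))%nat with n in A by lia.
    replace (N + (m - N))%nat with m in B by lia.
    rewrite Cmod_sub_sym in B. lra. }
  destruct (HC Re) as [a Ha].
  { intros. rewrite <- re_minus. apply re_le_Cmod. }
  destruct (HC Im) as [b Hb].
  { intros. rewrite <- im_minus. apply im_le_Cmod. }
  exists (a, b). split; assumption.
Qed.

(** * Finite sums *)

Lemma csum_ext (n : nat) (f g : nat -> C) :
  (forall k, (k < n)%nat -> f k = g k) -> csum n f = csum n g.
Proof.
  induction n as [|n IH]; simpl; intros H; [reflexivity|].
  rewrite IH, H; auto.
Qed.

Lemma csum_plus (n : nat) (f g : nat -> C) :
  csum n (fun k => f k + g k) = csum n f + csum n g.
Proof. induction n as [|n IH]; simpl; [ring | rewrite IH; ring]. Qed.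

Lemma csum_scal (n : nat) (a : C) (f : nat -> C) : csum n (fun k => a * f k) = a * csum n f.
Proof. induction n as [|n IH]; simpl; [ring | rewrite IH; ring]. Qed.

Lemma csum_minus (n : nat) (f g : nat -> C) :
  csum n (fun k => f k - g k) = csum n f - csum n g.
Proof. induction n as [|n IH]; simpl; [ring | rewrite IH; ring]. Qed.

Lemma csum_first (n : nat) (f : nat -> C) : csum (S n) f = f O + csum n (fun k => f (S k)).
Proof.
  induction n as [|n IH]; [simpl; ring|].
  change (csum (S (S n)) f) with (csum (S n) f + f (S n)). rewrite IH. simpl. ring.
Qed.

Lemma csum_telescope (n : nat) (g : nat -> C) :
  csum n (fun k => g (S k) - g k) = g n - g O.
Proof. induction n as [|n IH]; simpl; [ring | rewrite IH; ring]. Qed.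

Lemma csum_add (n k : nat) (f : nat -> C) :
  csum (n + k) f = csum n f + csum k (fun j => f (n + j)%nat).
Proof.
  induction k as [|k IH]; [rewrite Nat.add_0_r; simpl; ring|].
  rewrite Nat.add_succ_r. simpl. rewrite IH. ring.
Qed.

Lemma csum_Cmod_geom (n k : nat) (f : nat -> C) (M r : R) :
  (0 <= M)%R -> (0 <= r < 1)%R -> (forall j, (Cmod (f (n + j)%nat) <= M * r ^ j)%R) ->
  (Cmod (csum k (fun j => f (n + j)%nat)) <= M / (1 - r))%R.
Proof.
  intros HM Hr H.
  assert (A : (Cmod (csum k (fun j => f (n + j)%nat)) <= M * ((1 - r ^ k) / (1 - r)))%R).
  { induction k as [|k IH].
    - simpl. rewrite Cmod_0. right. field. lra.
    - simpl csum. eapply Rle_trans; [apply Cmod_triangle|].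
      eapply Rle_trans; [apply Rplus_le_compat; [exact IH | apply H]|].
      right. simpl. field. lra. }
  eapply Rle_trans; [exact A|]. unfold Rdiv.
  apply Rmult_le_compat_l; auto.
  rewrite <- (Rmult_1_l (/ (1 - r))) at 2.
  apply Rmult_le_compat_r.
  - left. apply Rinv_0_lt_compat. lra.
  - assert (0 <= r ^ k)%R by (apply pow_le; lra). lra.
Qed.

(** * Geometrically dominated series *)

Definition geo (f : nat -> C) : Prop :=
  exists M r, (0 <= M)%R /\ (0 <= r < 1)%R /\ forall n, (Cmod (f n) <= M * r ^ n)%R.

Lemma is_lim_seq_geom_scal (M r : R) :
  (0 <= r < 1)%R -> is_lim_seq (fun n => M * r ^ n)%R 0.
Proof.
  intros Hr. replace (Finite 0) with (Finite (M * 0)) by (f_equal; ring).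
  apply is_lim_seq_mult'; [apply is_lim_seq_const|].
  apply is_lim_seq_geom. rewrite Rabs_pos_eq; lra.
Qed.

Lemma cseries_unique (f : nat -> C) (l : C) : has_sum f l -> cseries f = l.
Proof.
  intros [H1 H2]. unfold cseries.
  rewrite (is_lim_seq_unique _ _ H1), (is_lim_seq_unique _ _ H2).
  destruct l; reflexivity.
Qed.

Lemma geo_tail_sum (f : nat -> C) (M r : R) :
  (0 <= M)%R -> (0 <= r < 1)%R -> (forall n, (Cmod (f n) <= M * r ^ n)%R) ->
  forall n k, (Cmod (csum (n + k) f - csum n f) <= M / (1 - r) * r ^ n)%R.
Proof.
  intros HM Hr H n k. rewrite csum_add.
  replace (csum n f + csum k (fun j => f (n + j)%nat) - csum n f)
    with (csum k (fun j => f (n + j)%nat)) by ring.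
  replace (M / (1 - r) * r ^ n)%R with ((M * r ^ n) / (1 - r))%R by (field; lra).
  apply csum_Cmod_geom; auto.
  - apply Rmult_le_pos; auto. apply pow_le; lra.
  - intros j. eapply Rle_trans; [apply H|]. rewrite pow_add. lra.
Qed.

Lemma geo_has_sum (f : nat -> C) : geo f -> has_sum f (cseries f).
Proof.
  intros (M & r & HM & Hr & H).
  destruct (clim_cauchy (fun n => csum n f) (fun n => M / (1 - r) * r ^ n)%R) as [l Hl].
  - now apply geo_tail_sum.
  - now apply is_lim_seq_geom_scal.
  - now rewrite (cseries_unique f l Hl).
Qed.

Lemma geo_tail (f : nat -> C) (M r : R) :
  (0 <= M)%R -> (0 <= r < 1)%R -> (forall n, (Cmod (f n) <= M * r ^ n)%R) ->
  forall n, (Cmod (cseries f - csum n f) <= M / (1 - r) * r ^ n)%R.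
Proof.
  intros HM Hr H n.
  assert (HS : has_sum f (cseries f)) by (apply geo_has_sum; exists M, r; auto).
  apply (Cmod_lim_le _ _ (csum n f) (M / (1 - r) * r ^ n)%R n HS).
  intros m Hm. replace m with (n + (m - n))%nat by lia.
  now apply geo_tail_sum.
Qed.

Lemma geo_cseries_le (f : nat -> C) (M r : R) :
  (0 <= M)%R -> (0 <= r < 1)%R -> (forall n, (Cmod (f n) <= M * r ^ n)%R) ->
  (Cmod (cseries f) <= M / (1 - r))%R.
Proof.
  intros HM Hr H. assert (T := geo_tail f M r HM Hr H O). simpl in T.
  rewrite Rmult_1_r in T. now replace (cseries f - 0) with (cseries f) in T by ring.
Qed.

Lemma has_sum_ext (f g : nat -> C) (l : C) :
  (forall n, f n = g n) -> has_sum f l -> has_sum g l.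
Proof. intros H. apply clim_ext. intros n. now apply csum_ext. Qed.

Lemma has_sum_scal (a : C) (f : nat -> C) (l : C) :
  has_sum f l -> has_sum (fun n => a * f n) (a * l).
Proof.
  intros H. unfold has_sum. eapply clim_ext; [intros n; symmetry; apply csum_scal|].
  now apply clim_scal.
Qed.

Lemma has_sum_minus (f g : nat -> C) (l m : C) :
  has_sum f l -> has_sum g m -> has_sum (fun n => f n - g n) (l - m).
Proof.
  intros Hf Hg. unfold has_sum. eapply clim_ext; [intros n; symmetry; apply csum_minus|].
  now apply clim_minus.
Qed.

Lemma has_sum_plus (f g : nat -> C) (l m : C) :
  has_sum f l -> has_sum g m -> has_sum (fun n => f n + g n) (l + m).
Proof.
  intros Hf Hg. unfold has_sum. eapply clim_ext; [intros n; symmetry; apply csum_plus|].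
  now apply clim_plus.
Qed.

Lemma has_sum_telescope (g : nat -> C) :
  g O = 0 -> clim g 0 -> has_sum (fun n => g (S n) - g n) 0.
Proof.
  intros H0 Hg. apply clim_ext with g; auto.
  intros n. rewrite csum_telescope, H0. ring.
Qed.

Lemma cseries_ext (f g : nat -> C) : (forall n, f n = g n) -> cseries f = cseries g.
Proof.
  intros H. unfold cseries.
  f_equal; f_equal; apply Lim_seq_ext; intros n; now rewrite (csum_ext n f g).
Qed.

Lemma geo_ext (f g : nat -> C) : (forall n, f n = g n) -> geo f -> geo g.
Proof.
  intros E (M & r & HM & Hr & H). exists M, r. repeat split; try tauto.
  intros n. now rewrite <- E.
Qed.

Lemma geo_scal (a : C) (f : nat -> C) : geo f -> geo (fun n => a * f n).
Proof.
  intros (M & r & HM & Hr & H). exists (Cmod a * M)%R, r. repeat split; try tauto.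
  - apply Rmult_le_pos; auto using Cmod_ge_0.
  - intros n. rewrite Cmod_mult, Rmult_assoc.
    apply Rmult_le_compat_l; auto using Cmod_ge_0.
Qed.

Lemma geo_clim_0 (f : nat -> C) : geo f -> clim f 0.
Proof.
  intros (M & r & HM & Hr & H). apply clim_le with (fun n => M * r ^ n)%R.
  - intros n. now replace (f n - 0) with (f n) by ring.
  - now apply is_lim_seq_geom_scal.
Qed.

Lemma cseries_scal (a : C) (f : nat -> C) :
  geo f -> cseries (fun n => a * f n) = a * cseries f.
Proof. intros H. apply cseries_unique, has_sum_scal, geo_has_sum, H. Qed.

(** * Summation by diagonals and Cauchy products *)

Lemma pow_lin_lim (r : R) : (0 <= r < 1)%R -> is_lim_seq (fun n => INR n * r ^ n)%R 0.
Proof.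
  intros Hr.
  destruct (Req_dec r 0) as [->|Hr0].
  - apply is_lim_seq_ext with (fun _ => 0%R); [|apply is_lim_seq_const].
    intros [|n]; simpl; ring.
  (* With [r = s * s], Bernoulli's inequality for [1 / s] bounds [INR n * s ^ n] by a constant, and
     the second factor [s ^ n] provides the decay. *)
  - set (s := sqrt r).
    assert (Hs : (s * s = r)%R) by (apply sqrt_sqrt; lra).
    assert (Hs0 : (0 < s)%R) by (apply sqrt_lt_R0; lra).
    assert (Hs1 : (s < 1)%R) by nra.
    apply is_lim_seq_0_le with (fun n => / (/ s - 1) * s ^ n)%R;
      [|apply is_lim_seq_geom_scal; lra].
    intros n. split; [apply Rmult_le_pos; [apply pos_INR | apply pow_le; lra]|].
    assert (Hd : (0 < / s - 1)%R).
    { assert (1 < / s)%R; [|lra]. rewrite <- Rinv_1. apply Rinv_lt_contravar; lra. }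
    assert (B := poly n (/ s - 1) Hd).
    replace (1 + (/ s - 1))%R with (/ s)%R in B by ring.
    rewrite pow_inv in B.
    assert (Hp : (0 < s ^ n)%R) by (apply pow_lt; lra).
    rewrite <- Hs, Rpow_mult_distr.
    apply Rmult_le_reg_l with (/ s - 1)%R; auto.
    replace ((/ s - 1) * (/ (/ s - 1) * s ^ n))%R with (s ^ n)%R
      by (rewrite <- Rmult_assoc, Rinv_r; [ring | lra]).
    apply Rmult_le_reg_r with (/ s ^ n)%R; [now apply Rinv_0_lt_compat|].
    replace ((/ s - 1) * (INR n * (s ^ n * s ^ n)) * / s ^ n)%R
      with ((INR n * (/ s - 1)) * s ^ n)%R by (field; lra).
    rewrite Rinv_r by lra.
    apply Rle_trans with (/ s ^ n * s ^ n)%R; [|rewrite Rinv_l; lra].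
    apply Rmult_le_compat_r; lra.
Qed.

(** Both sides run over the triangle [j + n < K], once by diagonals and once by rows. Passing to
    [S K] adds one entry to each old row and a new row with a single entry. *)
Lemma csum_triangle (v : nat -> nat -> C) (K : nat) :
  csum K (fun k => csum (S k) (fun j => v j (k - j)%nat))
  = csum K (fun j => csum (K - j) (v j)).
Proof.
  induction K as [|K IH]; [reflexivity|].
  change (csum (S K) (fun k => csum (S k) (fun j => v j (k - j)%nat)))
    with (csum K (fun k => csum (S k) (fun j => v j (k - j)%nat))
          + (csum K (fun j => v j (K - j)%nat) + v K (K - K)%nat)).
  rewrite IH.
  change (csum (S K) (fun j => csum (S K - j) (v j)))
    with (csum K (fun j => csum (S K - j) (v j)) + csum (S K - K) (v K)).
  replace (S K - K)%nat with 1%nat by lia.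
  rewrite Nat.sub_diag.
  rewrite (csum_ext K (fun j => csum (S K - j) (v j))
             (fun j => csum (K - j) (v j) + v j (K - j)%nat)).
  - rewrite csum_plus. simpl. ring.
  - intros k Hk. replace (S K - k)%nat with (S (K - k)) by lia. reflexivity.
Qed.

Lemma csum_Cmod_const (n : nat) (f : nat -> C) (M : R) :
  (forall k, (k < n)%nat -> (Cmod (f k) <= M)%R) -> (Cmod (csum n f) <= INR n * M)%R.
Proof.
  induction n as [|n IH]; intros H.
  - simpl. rewrite Cmod_0. lra.
  - simpl csum. rewrite S_INR. eapply Rle_trans; [apply Cmod_triangle|].
    assert (A := IH (fun k Hk => H k (Nat.lt_lt_succ_r _ _ Hk))).
    assert (B := H n (Nat.lt_succ_diag_r n)). lra.
Qed.

(** By [csum_triangle] the partial sum cuts row [j] at [K - j]. Each of the [K] missing tails is at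
    most [M / (1 - r) * r ^ K], so the total error is of order [K * r ^ K]. *)
Lemma has_sum_diagonal (v : nat -> nat -> C) (M r : R) :
  (0 <= M)%R -> (0 <= r < 1)%R -> (forall j n, (Cmod (v j n) <= M * r ^ (j + n))%R) ->
  has_sum (fun k => csum (S k) (fun j => v j (k - j)%nat)) (cseries (fun j => cseries (v j))).
Proof.
  intros HM Hr H.
  assert (Hrow : forall j n, (Cmod (v j n) <= M * r ^ j * r ^ n)%R).
  { intros j n. rewrite Rmult_assoc, <- pow_add. apply H. }
  assert (HMj : forall j, (0 <= M * r ^ j)%R).
  { intros j. apply Rmult_le_pos; auto. apply pow_le; lra. }
  assert (Hs : has_sum (fun j => cseries (v j)) (cseries (fun j => cseries (v j)))).
  { apply geo_has_sum. exists (M / (1 - r))%R, r. repeat split; try tauto.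
    - apply Rmult_le_pos; auto. left. apply Rinv_0_lt_compat. lra.
    - intros j. replace (M / (1 - r) * r ^ j)%R with (M * r ^ j / (1 - r))%R by (field; lra).
      now apply geo_cseries_le. }
  unfold has_sum.
  apply clim_zero_le with (v := fun K => csum K (fun j => cseries (v j)))
    (e := fun K => (M / (1 - r) * (INR K * r ^ K))%R); auto.
  - intros K. cbv beta. rewrite csum_triangle, Cmod_sub_sym, <- csum_minus.
    replace (M / (1 - r) * (INR K * r ^ K))%R with (INR K * (M / (1 - r) * r ^ K))%R by ring.
    apply csum_Cmod_const. intros j Hj.
    eapply Rle_trans; [apply (geo_tail (v j) (M * r ^ j) r); auto|].
    right. replace K with (j + (K - j))%nat at 2 by lia. rewrite pow_add. field. lra.
  - replace (Finite 0) with (Finite (M / (1 - r) * 0)) by (f_equal; ring).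
    apply is_lim_seq_mult'; [apply is_lim_seq_const | now apply pow_lin_lim].
Qed.

Lemma has_sum_cauchy_product (f g : nat -> C) :
  geo f -> geo g ->
  has_sum (fun k => csum (S k) (fun j => f j * g (k - j)%nat)) (cseries f * cseries g).
Proof.
  intros Gf Gg.
  destruct Gf as (M & r & HM & Hr & Hf) eqn:Ef. destruct Gg as (N & s & HN & Hs & Hg) eqn:Eg.
  replace (cseries f * cseries g) with (cseries (fun j => cseries (fun n => f j * g n))).
  - apply (has_sum_diagonal (fun j n => f j * g n) (M * N) (Rmax r s)).
    + now apply Rmult_le_pos.
    + split; [eapply Rle_trans; [|apply Rmax_l]; lra | apply Rmax_lub_lt; lra].
    + intros j n. rewrite Cmod_mult, pow_add.
      replace (M * N * (Rmax r s ^ j * Rmax r s ^ n))%R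
        with ((M * Rmax r s ^ j) * (N * Rmax r s ^ n))%R by ring.
      apply Rmult_le_compat; auto using Cmod_ge_0.
      * eapply Rle_trans; [apply Hf|]. apply Rmult_le_compat_l; auto.
        apply pow_incr. split; [lra | apply Rmax_l].
      * eapply Rle_trans; [apply Hg|]. apply Rmult_le_compat_l; auto.
        apply pow_incr. split; [lra | apply Rmax_r].
  - rewrite (cseries_ext (fun j => cseries (fun n => f j * g n)) (fun j => cseries g * f j)).
    + rewrite cseries_scal by exact Gf. ring.
    + intros j. rewrite cseries_scal by exact Gg. ring.
Qed.

(** * Pochhammer symbols *)

Lemma RtoC_INR_S (n : nat) : RtoC (INR (S n)) = RtoC (INR n) + 1.
Proof. now rewrite S_INR, RtoC_plus. Qed.

Lemma RtoC_INR_add (m n : nat) : RtoC (INR (m + n)) = RtoC (INR m) + RtoC (INR n).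
Proof. now rewrite plus_INR, RtoC_plus. Qed.

Lemma RtoC_INR_fact_S (n : nat) :
  RtoC (INR (fact (S n))) = (RtoC (INR n) + 1) * RtoC (INR (fact n)).
Proof. rewrite fact_simpl, mult_INR, RtoC_mult, RtoC_INR_S. reflexivity. Qed.

Lemma RtoC_neq_0 (x : R) : x <> 0%R -> RtoC x <> 0.
Proof. intros H E. apply H. now injection E. Qed.

Lemma RtoC_INR_fact_neq_0 (n : nat) : RtoC (INR (fact n)) <> 0.
Proof. apply RtoC_neq_0, INR_fact_neq_0. Qed.

Lemma RtoC_INR_S_neq_0 (n : nat) : RtoC (INR n) + 1 <> 0.
Proof. rewrite <- RtoC_INR_S. apply RtoC_neq_0, not_0_INR. discriminate. Qed.

Lemma nonpos_int_shift (z : C) (n : nat) : ~ nonpos_int z -> ~ nonpos_int (z + RtoC (INR n)).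
Proof.
  intros H [k Hk]. apply H. exists (n + k)%nat.
  rewrite plus_INR. replace (- (INR n + INR k))%R with (- INR k - INR n)%R by ring.
  rewrite RtoC_minus, <- Hk. ring.
Qed.

Lemma nonpos_int_add_neq_0 (z : C) (n : nat) : ~ nonpos_int z -> z + RtoC (INR n) <> 0.
Proof.
  intros H E. apply H. exists n. rewrite RtoC_opp.
  replace z with (z + RtoC (INR n) - RtoC (INR n)) by ring. rewrite E. ring.
Qed.

Lemma nonpos_int_neq_0 (z : C) : ~ nonpos_int z -> z <> 0.
Proof.
  intros H E. apply (nonpos_int_add_neq_0 z 0 H). simpl. rewrite E. ring.
Qed.

Lemma poch_neq_0 (z : C) (n : nat) : ~ nonpos_int z -> poch z n <> 0.
Proof.
  intros H. induction n as [|n IH]; simpl; [apply C1_nz|].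
  apply Cmult_neq_0; auto using nonpos_int_add_neq_0.
Qed.

Lemma poch_S_l (z : C) (n : nat) : poch z (S n) = z * poch (z + 1) n.
Proof.
  induction n as [|n IH]; [simpl; ring|].
  change (poch z (S (S n))) with (poch z (S n) * (z + RtoC (INR (S n)))).
  rewrite IH, RtoC_INR_S. simpl. ring.
Qed.

Lemma poch_add (z : C) (m n : nat) : poch z (m + n) = poch z m * poch (z + RtoC (INR m)) n.
Proof.
  induction n as [|n IH]; [rewrite Nat.add_0_r; simpl; ring|].
  rewrite Nat.add_succ_r. simpl. rewrite IH, RtoC_INR_add. ring.
Qed.

Lemma poch_1 (n : nat) : poch 1 n = RtoC (INR (fact n)).
Proof.
  induction n as [|n IH]; [reflexivity|].
  rewrite RtoC_INR_fact_S. simpl. rewrite IH. ring.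
Qed.

Lemma nonpos_int_1 : ~ nonpos_int 1.
Proof.
  intros [k E]. injection E as E. assert (H := pos_INR k). lra.
Qed.

Lemma poch_double (z : C) (n : nat) :
  poch z (2 * n) = 4 ^ n * poch (z / 2) n * poch ((z + 1) / 2) n.
Proof.
  induction n as [|n IH]; [simpl; ring|].
  replace (2 * S n)%nat with (S (S (2 * n))) by lia.
  change (poch z (S (S (2 * n))))
    with (poch z (2 * n) * (z + RtoC (INR (2 * n))) * (z + RtoC (INR (S (2 * n))))).
  rewrite IH, RtoC_INR_S, mult_INR, RtoC_mult.
  replace (INR 2) with 2%R by (simpl; ring).
  simpl. field.
Qed.

(** The finitely many terms before the ratio test applies are absorbed into [M], one at a time by
    shifting the sequence; each shift costs a factor [1 / r]. *)
Lemma ratio_bound (r : R) (N : nat) (f : nat -> C) :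
  (0 < r)%R -> (forall n, (N <= n)%nat -> (Cmod (f (S n)) <= r * Cmod (f n))%R) ->
  exists M, (0 <= M)%R /\ forall n, (Cmod (f n) <= M * r ^ n)%R.
Proof.
  intros Hr. revert f. induction N as [|N IH]; intros f H.
  - exists (Cmod (f O)). split; [apply Cmod_ge_0|].
    induction n as [|n IHn]; [simpl; lra|].
    eapply Rle_trans; [apply H; lia|]. simpl. nra.
  - destruct (IH (fun n => f (S n))) as (M & HM & HM').
    { intros n Hn. apply H. lia. }
    exists (Rmax (Cmod (f O)) (M / r)). split.
    + eapply Rle_trans; [apply Cmod_ge_0 | apply Rmax_l].
    + intros [|n].
      * simpl. rewrite Rmult_1_r. apply Rmax_l.
      * eapply Rle_trans; [apply HM'|].
        replace (M * r ^ n)%R with (M / r * r ^ S n)%R by (simpl; field; lra).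
        apply Rmult_le_compat_r; [apply pow_le; lra | apply Rmax_r].
Qed.

Lemma shift_ratio (a c : C) :
  exists N, forall n, (N <= n)%nat ->
    (Cmod (a + RtoC (INR n)) <= 5 / 4 * Cmod (c + RtoC (INR n)))%R /\ c + RtoC (INR n) <> 0.
Proof.
  (* For [n >= 4|a| + 5|c|] one has [|a| + n <= 5/4 * (n - |c|)], and the triangle inequality gives
     the claim. *)
  destruct (nfloor_ex (4 * Cmod a + 5 * Cmod c + 1)) as [N HN].
  { assert (A := Cmod_ge_0 a). assert (B := Cmod_ge_0 c). lra. }
  exists (S N). intros n Hn.
  apply le_INR in Hn. rewrite S_INR in Hn.
  assert (A := Cmod_ge_0 a). assert (B := Cmod_ge_0 c).
  assert (T1 := Cmod_triangle a (RtoC (INR n))).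
  assert (T2 := Cmod_triangle (c + RtoC (INR n)) (- c)).
  replace (c + RtoC (INR n) + - c) with (RtoC (INR n)) in T2 by ring.
  rewrite Cmod_opp in T2. rewrite Cmod_INR in T1, T2.
  split; [lra|].
  apply Cmod_gt_0. lra.
Qed.

Lemma poch_ratio_bound (a c : C) :
  ~ nonpos_int c ->
  exists M, (0 <= M)%R /\ forall n, (Cmod (poch a n / poch c n) <= M * (5 / 4) ^ n)%R.
Proof.
  intros Hc. destruct (shift_ratio a c) as [N HN].
  apply (ratio_bound (5 / 4) N (fun n => poch a n / poch c n)); [lra|].
  intros n Hn. destruct (HN n Hn) as [H1 H2]. simpl.
  replace (poch a n * (a + RtoC (INR n)) / (poch c n * (c + RtoC (INR n))))
    with ((a + RtoC (INR n)) / (c + RtoC (INR n)) * (poch a n / poch c n))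
    by (field; split; auto using poch_neq_0).
  rewrite Cmod_mult. apply Rmult_le_compat_r; [apply Cmod_ge_0|].
  rewrite Cmod_div by assumption.
  apply Cmod_gt_0 in H2.
  apply Rmult_le_reg_r with (Cmod (c + RtoC (INR n))); auto.
  unfold Rdiv at 1. rewrite Rmult_assoc, Rinv_l by lra. lra.
Qed.

Lemma poch_fact_bound (a : C) :
  exists M, (0 <= M)%R /\
    forall n, (Cmod (poch a n / RtoC (INR (fact n))) <= M * (5 / 4) ^ n)%R.
Proof.
  destruct (poch_ratio_bound a 1 nonpos_int_1) as (M & HM & H).
  exists M. split; auto. intros n. rewrite <- poch_1. apply H.
Qed.

(** * Complex powers of positive reals *)

Lemma cexp_plus (z w : C) : cexp (z + w) = cexp z * cexp w.
Proof.
  unfold cexp. rewrite re_plus, im_plus, exp_plus, cos_plus, sin_plus.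
  unfold Cmult; simpl. f_equal; ring.
Qed.

Lemma cexp_0 : cexp 0 = 1.
Proof. unfold cexp, RtoC; simpl. rewrite exp_0, cos_0, sin_0. f_equal; ring. Qed.

Lemma cexp_neq_0 (z : C) : cexp z <> 0.
Proof.
  intros E. assert (H := cexp_plus z (- z)).
  rewrite E, Cplus_opp_r, cexp_0, Cmult_0_l in H. now apply C1_nz.
Qed.

Lemma Cmod_cexp (z : C) : Cmod (cexp z) = exp (Re z).
Proof.
  transitivity (sqrt (exp (Re z) ^ 2)); [|apply sqrt_pow2; left; apply exp_pos].
  unfold cexp, Cmod; cbn [fst snd]. f_equal. assert (H := sin2_cos2 (Im z)). unfold Rsqr in H.
  transitivity (exp (Re z) ^ 2 * (sin (Im z) * sin (Im z) + cos (Im z) * cos (Im z)))%R;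
    [ring | rewrite H; ring].
Qed.

Lemma cpowR_plus (a : R) (z w : C) : cpowR a (z + w) = cpowR a z * cpowR a w.
Proof. unfold cpowR. rewrite <- cexp_plus. f_equal. ring. Qed.

Lemma cpowR_neq_0 (a : R) (z : C) : cpowR a z <> 0.
Proof. apply cexp_neq_0. Qed.

Lemma cpowR_mult (a b : R) (z : C) :
  (0 < a)%R -> (0 < b)%R -> cpowR (a * b) z = cpowR a z * cpowR b z.
Proof.
  intros Ha Hb. unfold cpowR. rewrite <- cexp_plus, ln_mult by assumption.
  rewrite RtoC_plus. f_equal. ring.
Qed.

Lemma cpowR_0 (a : R) : cpowR a 0 = 1.
Proof. unfold cpowR. rewrite Cmult_0_l. apply cexp_0. Qed.

Lemma cpowR_1 (a : R) : (0 < a)%R -> cpowR a 1 = RtoC a.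
Proof.
  intros Ha. unfold cpowR. rewrite Cmult_1_l. unfold cexp, RtoC; simpl.
  rewrite exp_ln, cos_0, sin_0 by assumption. f_equal; ring.
Qed.

(** * The reciprocal Gamma function *)

(** The inverted Gauss sequence converges for every [z], poles of Gamma included, so its limit
    [rGamma] is a total [1 / Gamma]. At [n = 0] the power rests on the convention [ln 0 = 0], which
    is why later arguments start at [S n]. *)
Definition rgauss_seq (z : C) (n : nat) : C :=
  poch z (S n) / (RtoC (INR (fact n)) * cpowR (INR n) z).

Definition rGamma (z : C) : C :=
  (real (Lim_seq (fun n => Re (rgauss_seq z n))),
   real (Lim_seq (fun n => Im (rgauss_seq z n)))).

(** The quotient of the inverted Gauss sequence at [n] and at [n - 1], with [h = 1 / n]: the
    function [(1 + z h) (1 - h)^z]. *)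
Definition gauss_ratio (z : C) (h : R) : C := (1 + z * RtoC h) * cexp (z * RtoC (ln (1 - h))).

(** The value at [h = 0] is 1 and the derivative is [O(h)], because the first-order terms of
    [1 + z h] and [(1 - h)^z] cancel. *)
Lemma gauss_ratio_bound (z : C) :
  exists K, (0 <= K)%R /\
    forall h, (0 <= h <= / 2)%R -> (Cmod (gauss_ratio z h - 1) <= K * h ^ 2)%R.
Proof.
  destruct z as [x y].
  set (e := fun h => cexp ((x, y) * RtoC (ln (1 - h)))).
  (* [d] is the derivative of [gauss_ratio] in [h]: [-z (1 + z) h (1 - h)^(z - 1)]. *)
  set (d := fun h => - ((x, y) * (1 + (x, y))) * RtoC (h / (1 - h)) * e h).
  (* On [[0, 1/2]] one has [h / (1 - h) <= 2 h] and [|ln (1 - h)| <= ln 2 <= 1], which give the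
     factors [2] and [exp |x|]. *)
  set (B := (2 * Cmod ((x, y) * (1 + (x, y))) * exp (Rabs x))%R).
  assert (HB : (0 <= B)%R).
  { unfold B. apply Rmult_le_pos; [|left; apply exp_pos].
    assert (H := Cmod_ge_0 ((x, y) * (1 + (x, y)))). lra. }
  assert (Hd : forall h, (0 <= h <= / 2)%R -> (Cmod (d h) <= B * h)%R).
  { intros h Hh. unfold d, B, e. rewrite !Cmod_mult, Cmod_opp, Cmod_mult, Cmod_cexp, Cmod_R.
    rewrite re_scal_r. unfold Re at 1; simpl fst.
    assert (Hln : (Rabs (ln (1 - h)) <= 1)%R).
    { rewrite Rabs_left1.
      - assert (L : (ln 2 <= 1)%R).
        { assert (H := ln_lt_2). rewrite <- (ln_exp 1).
          assert (E := exp_ineq1 1). left. apply ln_increasing; lra. }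
        assert (ln (/ 2) <= ln (1 - h))%R by (apply ln_le; lra).
        rewrite ln_Rinv in H by lra. lra.
      - rewrite <- ln_1. apply ln_le; lra. }
    assert (He : (exp (x * ln (1 - h)) <= exp (Rabs x))%R).
    { assert (x * ln (1 - h) <= Rabs x)%R.
      { eapply Rle_trans; [apply Rle_abs|]. rewrite Rabs_mult.
        assert (H := Rabs_pos x). nra. }
      destruct H as [H | ->]; [left; now apply exp_increasing | lra]. }
    assert (Hq : (Rabs (h / (1 - h)) <= 2 * h)%R).
    { rewrite Rabs_pos_eq.
      - apply Rmult_le_reg_r with (1 - h)%R; [lra|]. unfold Rdiv.
        rewrite Rmult_assoc, Rinv_l by lra. nra.
      - apply Rmult_le_pos; [lra|]. left; apply Rinv_0_lt_compat; lra. }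
    assert (P1 := Cmod_ge_0 (x, y)). assert (P2 := Cmod_ge_0 (1 + (x, y))).
    assert (P3 := exp_pos (x * ln (1 - h))).
    replace (2 * (Cmod (x, y) * Cmod (1 + (x, y))) * exp (Rabs x) * h)%R
      with ((Cmod (x, y) * Cmod (1 + (x, y))) * (2 * h) * exp (Rabs x))%R by ring.
    apply Rmult_le_compat; auto; [|lra|].
    - apply Rmult_le_pos; [nra | apply Rabs_pos].
    - apply Rmult_le_compat_l; [nra | exact Hq]. }
  assert (Hre : forall h, (0 <= h <= / 2)%R ->
            is_derive (fun t => Re (gauss_ratio (x, y) t)) h (Re (d h))).
  { intros h Hh. unfold gauss_ratio, d, e, cexp, cpowR; simpl.
    auto_derive; [repeat split; lra|].
    unfold Rminus. rewrite ?Rmult_0_r, ?Ropp_0, ?Rplus_0_l, ?Rplus_0_r. field. lra. }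
  assert (Him : forall h, (0 <= h <= / 2)%R ->
            is_derive (fun t => Im (gauss_ratio (x, y) t)) h (Im (d h))).
  { intros h Hh. unfold gauss_ratio, d, e, cexp, cpowR; simpl.
    auto_derive; [repeat split; lra|].
    unfold Rminus. rewrite ?Rmult_0_r, ?Ropp_0, ?Rplus_0_l, ?Rplus_0_r. field. lra. }
  assert (H0 : gauss_ratio (x, y) 0 = 1).
  { unfold gauss_ratio. rewrite Rminus_0_r, ln_1, Cmult_0_r, cexp_0. ring. }
  (* The mean value theorem fails for complex values, so it is applied to [Re] and [Im] separately;
     hence the final constant [2 * B]. *)
  assert (key : forall (p : C -> R), (forall w, (Rabs (p w) <= Cmod w)%R) ->
     (forall h, (0 <= h <= / 2)%R -> is_derive (fun t => p (gauss_ratio (x, y) t)) h (p (d h))) ->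
     forall h, (0 <= h <= / 2)%R ->
       (Rabs (p (gauss_ratio (x, y) h) - p (gauss_ratio (x, y) 0%R)) <= B * h ^ 2)%R).
  { intros p Hp Hder h Hh.
    destruct (MVT_gen (fun t => p (gauss_ratio (x, y) t)) 0 h (fun t => p (d t))) as (c & Hc & E).
    - intros t Ht. rewrite Rmin_left, Rmax_right in Ht by lra. apply Hder. lra.
    - intros t Ht. rewrite Rmin_left, Rmax_right in Ht by lra.
      apply continuity_pt_filterlim, (ex_derive_continuous (fun t => p (gauss_ratio (x, y) t))).
      eexists. apply Hder. lra.
    - rewrite Rmin_left, Rmax_right in Hc by lra.
      rewrite E, Rabs_mult, Rminus_0_r, (Rabs_pos_eq h) by lra.
      assert (Q1 := Hp (d c)). assert (Q2 := Hd c ltac:(lra)).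
      replace (B * h ^ 2)%R with ((B * h) * h)%R by ring.
      apply Rmult_le_compat_r; [lra|]. nra. }
  exists (2 * B)%R. split; [lra|]. intros h Hh.
  eapply Rle_trans; [apply Cmod_le_abs|].
  rewrite re_minus, im_minus, <- H0.
  assert (K1 := key Re re_le_Cmod Hre h Hh).
  assert (K2 := key Im im_le_Cmod Him h Hh). lra.
Qed.

Lemma inv_succ_lim (K : R) : is_lim_seq (fun n => K / (INR n + 1))%R 0.
Proof.
  replace (Finite 0) with (Finite (K * 0)) by (f_equal; ring).
  apply is_lim_seq_mult'; [apply is_lim_seq_const|].
  apply (is_lim_seq_ext (fun n => / INR (S n))%R).
  - intros n. now rewrite S_INR.
  - apply (is_lim_seq_incr_1 (fun n => / INR n)%R).
    apply (is_lim_seq_inv INR p_infty); [apply is_lim_seq_INR | discriminate].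
Qed.

(** An infinite product whose factors differ from 1 by a summable amount. The majorant
    [K / ((n + 1) (n + 2))] is chosen because it telescopes, so every tail is explicit. *)
Lemma clim_of_product (u : nat -> C) (K : R) :
  (0 <= K)%R ->
  (forall n, (Cmod (u (S n) - u n) <= K / ((INR n + 1) * (INR n + 2)) * Cmod (u n))%R) ->
  exists l, clim u l /\ ((forall n, u n <> 0) -> l <> 0).
Proof.
  intros HK H.
  assert (P : forall n, (0 < INR n + 1)%R) by (intros n; assert (Q := pos_INR n); lra).
  assert (Hdiff : forall n, (K / ((INR n + 1) * (INR n + 2)) = K / (INR n + 1) - K / (INR (S n) + 1))%R).
  { intros n. rewrite S_INR. assert (Q := P n). field. lra. }
  assert (Hpos : forall n, (0 <= K / ((INR n + 1) * (INR n + 2)))%R).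
  { intros n. assert (Q := P n). apply Rmult_le_pos; auto. left. apply Rinv_0_lt_compat. nra. }
  assert (Hpos' : forall n, (0 <= K / (INR n + 1))%R).
  { intros n. apply Rmult_le_pos; auto. left. now apply Rinv_0_lt_compat. }
  set (M := (Cmod (u O) * exp K)%R).
  (* The left-hand side does not increase with [n], since [1 + x <= exp x] for each telescoping
     increment [x]. *)
  assert (Hb : forall n, (Cmod (u n) * exp (K / (INR n + 1)) <= M)%R).
  { induction n as [|n IH].
    - unfold M. simpl. right. f_equal. f_equal. field.
    - eapply Rle_trans; [|exact IH].
      assert (T := Cmod_triangle (u (S n) - u n) (u n)).
      replace (u (S n) - u n + u n) with (u (S n)) in T by ring.
      replace (K / (INR n + 1))%R
        with (K / ((INR n + 1) * (INR n + 2)) + K / (INR (S n) + 1))%R by (rewrite Hdiff; ring).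
      rewrite exp_plus, <- Rmult_assoc.
      apply Rmult_le_compat_r; [left; apply exp_pos|].
      assert (E := exp_ineq1_le (K / ((INR n + 1) * (INR n + 2)))).
      assert (Q := Cmod_ge_0 (u n)). specialize (H n). nra. }
  assert (HM : (0 <= M)%R) by (apply Rmult_le_pos; [apply Cmod_ge_0 | left; apply exp_pos]).
  assert (Hb' : forall n, (Cmod (u n) <= M)%R).
  { intros n. eapply Rle_trans; [|apply (Hb n)].
    rewrite <- (Rmult_1_r (Cmod (u n))) at 1.
    apply Rmult_le_compat_l; [apply Cmod_ge_0|].
    assert (E := exp_ineq1_le (K / (INR n + 1))). specialize (Hpos' n). lra. }
  assert (Hc : forall n k, (Cmod (u (n + k)%nat - u n)
                 <= M * (K / (INR n + 1) - K / (INR (n + k) + 1)))%R).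
  { intros n k. induction k as [|k IH].
    - rewrite Nat.add_0_r. replace (u n - u n) with (RtoC 0) by ring. rewrite Cmod_0. lra.
    - rewrite Nat.add_succ_r.
      eapply Rle_trans; [apply (Cmod_sub_triangle _ (u (n + k)%nat))|].
      specialize (H (n + k)%nat). rewrite Hdiff in H.
      specialize (Hb' (n + k)%nat).
      specialize (Hpos (n + k)%nat). rewrite Hdiff in Hpos. nra. }
  destruct (clim_cauchy u (fun n => M * K / (INR n + 1))%R) as [l Hl].
  - intros n k. eapply Rle_trans; [apply Hc|].
    specialize (Hpos' (n + k)%nat).
    replace (M * K / (INR n + 1))%R with (M * (K / (INR n + 1)))%R by (unfold Rdiv; ring).
    nra.
  - apply inv_succ_lim.
  - exists l. split; auto. intros Hu E.
    (* Past [2 K] the whole remaining sum of increments is at most [1/2], so the modulus never falls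
       below half of [Cmod (u N)]. *)
    destruct (nfloor_ex (2 * K)) as [N0 HN0]; [lra|].
    set (N := S N0).
    assert (HN : (K / (INR N + 1) <= / 2)%R).
    { apply Rmult_le_reg_r with (INR N + 1)%R; auto. unfold Rdiv.
      rewrite Rmult_assoc, Rinv_l by (specialize (P N); lra).
      unfold N. rewrite S_INR. lra. }
    (* This is the inequality that a product of factors [1 - x_k] is at least 1 minus the sum of the
       [x_k], with the sum telescoped. *)
    assert (Hlow : forall k, (Cmod (u N) * (1 - (K / (INR N + 1) - K / (INR (N + k) + 1)))
                              <= Cmod (u (N + k)%nat))%R).
    { induction k as [|k IH].
      - rewrite Nat.add_0_r. right. ring.
      - rewrite Nat.add_succ_r. specialize (H (N + k)%nat). rewrite Hdiff in H.
        assert (T := Cmod_triangle (u (N + k)%nat - u (S (N + k))) (u (S (N + k)))).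
        replace (u (N + k)%nat - u (S (N + k)) + u (S (N + k))) with (u (N + k)%nat) in T by ring.
        rewrite Cmod_sub_sym in T.
        assert (D := Hpos (N + k)%nat). rewrite Hdiff in D.
        assert (A := Hpos' (N + k)%nat). assert (A' := Hpos' (S (N + k))).
        assert (A'' : (K / (INR (N + k) + 1) <= K / (INR N + 1))%R).
        { unfold Rdiv. apply Rmult_le_compat_l; auto. apply Rinv_le_contravar; auto.
          rewrite plus_INR. assert (Q := pos_INR k). lra. }
        assert (Q := Cmod_ge_0 (u N)). assert (Q' := Cmod_ge_0 (u (N + k)%nat)).
        set (a := (K / (INR N + 1))%R) in *.
        set (b := (K / (INR (N + k) + 1))%R) in *.
        set (c := (K / (INR (S (N + k)) + 1))%R) in *.
        apply Rle_trans with (Cmod (u (N + k)%nat) * (1 - (b - c)))%R; [|lra].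
        apply Rle_trans with (Cmod (u N) * (1 - (a - b)) * (1 - (b - c)))%R.
        + rewrite Rmult_assoc. apply Rmult_le_compat_l; auto. nra.
        + apply Rmult_le_compat_r; lra. }
    assert (Hu' := proj1 (Cmod_gt_0 (u N)) (Hu N)).
    rewrite clim_eps in Hl.
    destruct (Hl (Cmod (u N) / 2)%R) as [N1 HN1]; [lra|].
    specialize (HN1 (N + N1)%nat ltac:(lia)). specialize (Hlow N1).
    rewrite E in HN1. replace (u (N + N1)%nat - 0) with (u (N + N1)%nat) in HN1 by ring.
    specialize (Hpos' (N + N1)%nat). nra.
Qed.

(** Stated from index 1 on, where the logarithms are genuine and [h = 1 / (n + 2)] lies in the range
    of [gauss_ratio_bound]. *)
Lemma rgauss_seq_S (z : C) (n : nat) :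
  rgauss_seq z (S (S n)) = gauss_ratio z (/ INR (S (S n))) * rgauss_seq z (S n).
Proof.
  unfold rgauss_seq, gauss_ratio.
  assert (P : (0 < INR (S n))%R) by (apply lt_0_INR; lia).
  assert (P' : (0 < INR (S (S n)))%R) by (apply lt_0_INR; lia).
  assert (Q : cpowR (INR (S (S n))) z * cexp (z * RtoC (ln (1 - / INR (S (S n)))))
              = cpowR (INR (S n)) z).
  { unfold cpowR. rewrite <- cexp_plus. f_equal.
    replace (1 - / INR (S (S n)))%R with (INR (S n) * / INR (S (S n)))%R.
    - rewrite ln_mult, ln_Rinv by (auto; now apply Rinv_0_lt_compat).
      rewrite RtoC_plus, RtoC_opp. ring.
    - rewrite (S_INR (S n)) in *. field. lra. }
  rewrite <- Q, (RtoC_INR_fact_S (S n)), <- RtoC_INR_S, RtoC_inv by lra.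
  change (poch z (S (S (S n)))) with (poch z (S (S n)) * (z + RtoC (INR (S (S n))))).
  field. repeat split; auto using cpowR_neq_0, cexp_neq_0, RtoC_INR_fact_neq_0.
  apply RtoC_neq_0. lra.
Qed.

Lemma rgauss_seq_lim (z : C) :
  exists l, clim (rgauss_seq z) l /\ (~ nonpos_int z -> l <> 0).
Proof.
  destruct (gauss_ratio_bound z) as (K & HK & H).
  destruct (clim_of_product (fun n => rgauss_seq z (S n)) K) as (l & Hl & Hl0); auto.
  - intros n. rewrite rgauss_seq_S.
    replace (gauss_ratio z (/ INR (S (S n))) * rgauss_seq z (S n) - rgauss_seq z (S n))
      with ((gauss_ratio z (/ INR (S (S n))) - 1) * rgauss_seq z (S n)) by ring.
    rewrite Cmod_mult. apply Rmult_le_compat_r; [apply Cmod_ge_0|].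
    assert (Q := pos_INR n). assert (E : INR (S (S n)) = (INR n + 2)%R) by (rewrite !S_INR; ring).
    eapply Rle_trans; [apply H|].
    + rewrite E. split; [left; apply Rinv_0_lt_compat; lra | apply Rinv_le_contravar; lra].
    + rewrite E. unfold Rdiv. apply Rmult_le_compat_l; auto.
      rewrite pow_inv. apply Rinv_le_contravar; nra.
  - exists l. split; [now apply clim_incr_1|]. intros Hz. apply Hl0. intros n.
    unfold rgauss_seq. intros E.
    apply (poch_neq_0 z (S (S n)) Hz).
    assert (D : RtoC (INR (fact (S n))) * cpowR (INR (S n)) z <> 0)
      by auto using Cmult_neq_0, RtoC_INR_fact_neq_0, cpowR_neq_0.
    replace (poch z (S (S n))) with
      (poch z (S (S n)) / (RtoC (INR (fact (S n))) * cpowR (INR (S n)) z)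
       * (RtoC (INR (fact (S n))) * cpowR (INR (S n)) z)).
    + rewrite E. ring.
    + field. split; auto using RtoC_INR_fact_neq_0, cpowR_neq_0.
Qed.

Lemma rGamma_clim (z : C) : clim (rgauss_seq z) (rGamma z).
Proof.
  destruct (rgauss_seq_lim z) as (l & Hl & _). unfold rGamma.
  destruct Hl as [H1 H2].
  rewrite (is_lim_seq_unique _ _ H1), (is_lim_seq_unique _ _ H2). now split.
Qed.

Lemma rGamma_neq_0 (z : C) : ~ nonpos_int z -> rGamma z <> 0.
Proof.
  intros Hz. destruct (rgauss_seq_lim z) as (l & Hl & H0).
  rewrite (clim_unique _ _ _ (rGamma_clim z) Hl). auto.
Qed.

Lemma Gamma_rGamma (z : C) : ~ nonpos_int z -> Gamma z = / rGamma z.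
Proof.
  intros Hz.
  assert (H : clim (gauss_seq z) (/ rGamma z)).
  { apply clim_ext with (fun n => / rgauss_seq z n).
    - intros n. unfold gauss_seq, rgauss_seq.
      field. repeat split; auto using RtoC_INR_fact_neq_0, cpowR_neq_0, poch_neq_0.
    - apply clim_inv; auto using rGamma_neq_0, rGamma_clim. }
  destruct H as [H1 H2]. unfold Gamma.
  rewrite (is_lim_seq_unique _ _ H1), (is_lim_seq_unique _ _ H2).
  now destruct (/ rGamma z).
Qed.

Lemma clim_linear_ratio (a : C) :
  clim (fun n => (RtoC (INR n) + a) / (RtoC (INR n) + 1)) 1.
Proof.
  apply clim_le with (fun n => Cmod (a - 1) / (INR n + 1))%R; [|apply inv_succ_lim].
  intros n.
  replace ((RtoC (INR n) + a) / (RtoC (INR n) + 1) - 1) with ((a - 1) / (RtoC (INR n) + 1))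
    by (field; apply RtoC_INR_S_neq_0).
  rewrite Cmod_div by apply RtoC_INR_S_neq_0.
  right. f_equal. rewrite <- RtoC_INR_S, Cmod_INR. apply S_INR.
Qed.

(** The two inverted Gauss sequences differ by the factor [(n + z + 2) / (n + 1)], which tends to 1.
    No pole has to be excluded. *)
Lemma rGamma_succ (z : C) : rGamma z = z * rGamma (z + 1).
Proof.
  apply clim_unique with (fun n => z * rgauss_seq (z + 1) (S n)).
  - apply clim_ext with
      (fun n => (RtoC (INR n) + (z + 2)) / (RtoC (INR n) + 1) * rgauss_seq z (S n)).
    + intros n. unfold rgauss_seq.
      rewrite cpowR_plus, (cpowR_1 (INR (S n))) by (apply lt_0_INR; lia).
      replace (z * (poch (z + 1) (S (S n))
                 / (RtoC (INR (fact (S n))) * (cpowR (INR (S n)) z * RtoC (INR (S n))))))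
        with (z * poch (z + 1) (S (S n))
                 / (RtoC (INR (fact (S n))) * (cpowR (INR (S n)) z * RtoC (INR (S n)))))
        by (unfold Cdiv; ring).
      rewrite <- poch_S_l.
      change (poch z (S (S (S n)))) with (poch z (S (S n)) * (z + RtoC (INR (S (S n))))).
      rewrite (RtoC_INR_S (S n)), (RtoC_INR_S n).
      field. repeat split; auto using RtoC_INR_fact_neq_0, cpowR_neq_0, RtoC_INR_S_neq_0.
    + replace (rGamma z) with (1 * rGamma z) by ring.
      apply clim_mult; [apply clim_linear_ratio | apply clim_incr_1, rGamma_clim].
  - apply clim_scal, clim_incr_1, rGamma_clim.
Qed.

Lemma rGamma_add (z : C) (n : nat) : rGamma z = poch z n * rGamma (z + RtoC (INR n)).
Proof.
  induction n as [|n IH].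
  - simpl. replace (z + 0) with z by ring. ring.
  - rewrite RtoC_INR_S, IH, (rGamma_succ (z + RtoC (INR n))). simpl.
    replace (z + RtoC (INR n) + 1) with (z + (RtoC (INR n) + 1)) by ring. ring.
Qed.

Lemma rGamma_1 : rGamma 1 = 1.
Proof.
  apply clim_unique with (fun n => rgauss_seq 1 (S n)); [apply clim_incr_1, rGamma_clim|].
  apply clim_ext with (fun n => (RtoC (INR n) + 2) / (RtoC (INR n) + 1));
    [|apply clim_linear_ratio].
  intros n. unfold rgauss_seq. rewrite cpowR_1 by (apply lt_0_INR; lia).
  rewrite poch_1, (RtoC_INR_fact_S (S n)), RtoC_INR_S.
  field. split; auto using RtoC_INR_fact_neq_0, RtoC_INR_S_neq_0.
Qed.

Lemma poch_rgauss (z : C) (n : nat) :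
  poch z (S n) = rgauss_seq z n * (RtoC (INR (fact n)) * cpowR (INR n) z).
Proof.
  unfold rgauss_seq. field. split; auto using RtoC_INR_fact_neq_0, cpowR_neq_0.
Qed.

(** Legendre's duplication formula. The limit constant is found by comparing the finite identity [E]
    at [c] with the same identity at 1, so no Stirling asymptotics are required. *)
Lemma rGamma_duplication (c : C) :
  2 * (rGamma (c / 2) * rGamma ((c + 1) / 2)) = cpowR 2 c * rGamma (1 / 2) * rGamma c.
Proof.
  (* [poch_double] rewritten in inverted Gauss sequences. The common power [X * X] of [INR (S n)] is
     cancelled, which leaves only the exponent [1/2]. *)
  assert (E : forall n (z : C),
    4 * 4 ^ S n * (rgauss_seq (z / 2) (S n) * rgauss_seq ((z + 1) / 2) (S n))
      * (RtoC (INR (fact (S n))) ^ 2 * cpowR (INR (S n)) (/ 2))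
    = cpowR 2 z * rgauss_seq z (2 * S n) * RtoC (INR (fact (2 * S n)))
      * (z + RtoC (INR (S (2 * S n))))).
  { intros n z.
    assert (P : (0 < INR (S n))%R) by (apply lt_0_INR; lia).
    assert (E1 : poch z (2 * S (S n)) = poch z (S (2 * S n)) * (z + RtoC (INR (S (2 * S n))))).
    { replace (2 * S (S n))%nat with (S (S (2 * S n))) by lia. reflexivity. }
    rewrite poch_double, !poch_rgauss in E1.
    replace (INR (2 * S n)) with (2 * INR (S n))%R in E1 by (rewrite mult_INR; simpl; ring).
    rewrite cpowR_mult in E1 by lra.
    replace (cpowR (INR (S n)) ((z + 1) / 2))
      with (cpowR (INR (S n)) (z / 2) * cpowR (INR (S n)) (/ 2)) in E1
      by (rewrite <- cpowR_plus; f_equal; field).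
    assert (E2 : cpowR (INR (S n)) z = cpowR (INR (S n)) (z / 2) * cpowR (INR (S n)) (z / 2))
      by (rewrite <- cpowR_plus; f_equal; field).
    rewrite E2 in E1. clear E2.
    assert (N0 := cpowR_neq_0 (INR (S n)) (z / 2)).
    set (X := cpowR (INR (S n)) (z / 2)) in *.
    assert (E3 : forall a b : C, a * (X * X) = b * (X * X) -> a = b).
    { intros a b Hab. replace a with (a * (X * X) / (X * X)) by (now field).
      rewrite Hab. now field. }
    apply E3.
    transitivity (4 ^ S (S n) *
       (rgauss_seq (z / 2) (S n) * (RtoC (INR (fact (S n))) * X)) *
       (rgauss_seq ((z + 1) / 2) (S n) *
        (RtoC (INR (fact (S n))) * (X * cpowR (INR (S n)) (/ 2))))).
    - rewrite (Cpow_S 4 (S n)). ring.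
    - rewrite E1. ring. }
  (* Quotient of [E n c] and [E n 1]: factorials, powers of 4 and the half power drop out, and the
     leftover linear factors have limit 1. *)
  assert (E' : forall n,
    2 * (rgauss_seq (c / 2) (S n) * rgauss_seq ((c + 1) / 2) (S n)) * rgauss_seq 1 (2 * S n)
    = cpowR 2 c * (rgauss_seq (1 / 2) (S n) * rgauss_seq 1 (S n)) * rgauss_seq c (2 * S n)
      * ((RtoC (INR (S n)) + (c + 1) / 2) / (RtoC (INR (S n)) + 1))).
  { intros n. assert (Ec := E n c). assert (E1 := E n 1).
    replace ((1 + 1) / 2) with (RtoC 1) in E1 by field.
    rewrite cpowR_1 in E1 by lra.
    rewrite (RtoC_INR_S (2 * S n)) in Ec, E1.
    rewrite mult_INR, RtoC_mult in Ec, E1.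
    replace (INR 2) with 2%R in Ec, E1 by (simpl; ring).
    assert (N1 := RtoC_INR_S_neq_0 (S n)).
    assert (N2 := RtoC_INR_fact_neq_0 (2 * S n)).
    assert (N3 := RtoC_INR_fact_neq_0 (S n)).
    assert (N4 := cpowR_neq_0 (INR (S n)) (/ 2)).
    assert (N5 : (4 : C) ^ S n <> 0) by (apply Cpow_nz, RtoC_neq_0; lra).
    set (F := RtoC (INR (fact (2 * S n)))) in *.
    set (Q := 4 * 4 ^ S n * (RtoC (INR (fact (S n))) ^ 2 * cpowR (INR (S n)) (/ 2))).
    assert (NQ : Q <> 0).
    { unfold Q. apply Cmult_neq_0; apply Cmult_neq_0; auto using Cpow_nz.
      apply RtoC_neq_0; lra. }
    set (A := rgauss_seq (c / 2) (S n) * rgauss_seq ((c + 1) / 2) (S n)) in *.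
    set (B := rgauss_seq (1 / 2) (S n) * rgauss_seq 1 (S n)) in *.
    set (U := rgauss_seq c (2 * S n)) in *. set (V := rgauss_seq 1 (2 * S n)) in *.
    set (m := RtoC (INR (S n))) in *.
    assert (Ec' : A = cpowR 2 c * U * F * (c + (2 * m + 1)) / Q).
    { transitivity (Q * A / Q); [now field|]. f_equal. rewrite <- Ec. unfold Q. ring. }
    assert (E1' : B = 2 * V * F * (1 + (2 * m + 1)) / Q).
    { transitivity (Q * B / Q); [now field|]. f_equal. rewrite <- E1. unfold Q. ring. }
    rewrite Ec', E1'. field. auto. }
  assert (L1 : clim (fun n => 2 * (rgauss_seq (c / 2) (S n) * rgauss_seq ((c + 1) / 2) (S n))
                              * rgauss_seq 1 (2 * S n))
                 (2 * (rGamma (c / 2) * rGamma ((c + 1) / 2)) * rGamma 1)).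
  { apply (clim_incr_1 (fun n => 2 * (rgauss_seq (c / 2) n * rgauss_seq ((c + 1) / 2) n)
                              * rgauss_seq 1 (2 * n))).
    apply clim_mult; [apply clim_scal, clim_mult; apply rGamma_clim|].
    apply (clim_double (rgauss_seq 1)), rGamma_clim. }
  assert (L2 : clim (fun n => 2 * (rgauss_seq (c / 2) (S n) * rgauss_seq ((c + 1) / 2) (S n))
                              * rgauss_seq 1 (2 * S n))
                 (cpowR 2 c * (rGamma (1 / 2) * rGamma 1) * rGamma c * 1)).
  { eapply clim_ext; [intros n; symmetry; apply E'|].
    apply (clim_incr_1 (fun n => cpowR 2 c * (rgauss_seq (1 / 2) n * rgauss_seq 1 n)
              * rgauss_seq c (2 * n) * ((RtoC (INR n) + (c + 1) / 2) / (RtoC (INR n) + 1)))).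
    apply clim_mult; [|apply clim_linear_ratio].
    apply clim_mult; [apply clim_scal, clim_mult; apply rGamma_clim|].
    apply (clim_double (rgauss_seq c)), rGamma_clim. }
  assert (E3 := clim_unique _ _ _ L1 L2). rewrite rGamma_1, !Cmult_1_r in E3. exact E3.
Qed.

(** * Regularized hypergeometric series at 1/2 *)

(** The denominator parameter is left out, so that either [/ poch c n] or [rGamma (c + n)] can
    supply it. *)
Definition hterm (a b : C) (n : nat) : C :=
  poch a n * poch b n / RtoC (INR (fact n)) * (/ 2) ^ n.

Definition hypF (a b c : C) : C := cseries (fun n => hterm a b n / poch c n).

Definition regF (a b c : C) : C := cseries (fun n => hterm a b n * rGamma (c + RtoC (INR n))).

Lemma two_neq_0 : (2 : C) <> 0.
Proof. apply RtoC_neq_0. lra. Qed.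

Lemma Cmod_half_pow (n : nat) : Cmod ((/ 2) ^ n) = ((/ 2) ^ n)%R.
Proof.
  rewrite Cmod_pow, Cmod_inv by apply two_neq_0. f_equal. f_equal.
  rewrite Cmod_R, Rabs_pos_eq; lra.
Qed.

Lemma hterm_0 (a b : C) : hterm a b 0 = 1.
Proof. unfold hterm. simpl. field. Qed.

Lemma hterm_S (a b : C) (n : nat) :
  hterm a b (S n)
  = hterm a b n * ((a + RtoC (INR n)) * (b + RtoC (INR n)) / (2 * (RtoC (INR n) + 1))).
Proof.
  unfold hterm. rewrite RtoC_INR_fact_S. simpl. field.
  split; auto using RtoC_INR_fact_neq_0, RtoC_INR_S_neq_0.
Qed.

(** In the ratio of consecutive terms, [a + n] is paired with [1 + n] and [b + n] with [c + n]. Both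
    quotients are eventually at most [5/4], and [25/32] is [(5/4)^2 / 2]. *)
Lemma regF_bound (a b c : C) :
  exists M, (0 <= M)%R /\
    forall n, (Cmod (hterm a b n * rGamma (c + RtoC (INR n))) <= M * (25 / 32) ^ n)%R.
Proof.
  destruct (shift_ratio a 1) as [N1 H1]. destruct (shift_ratio b c) as [N2 H2].
  apply (ratio_bound (25 / 32) (max N1 N2) (fun n => hterm a b n * rGamma (c + RtoC (INR n)))); [lra|].
  intros n Hn. destruct (H1 n ltac:(lia)) as [A1 B1]. destruct (H2 n ltac:(lia)) as [A2 B2].
  rewrite hterm_S, (rGamma_succ (c + RtoC (INR n))), RtoC_INR_S.
  replace (c + RtoC (INR n) + 1) with (c + (RtoC (INR n) + 1)) by ring.
  set (h := hterm a b n). set (g := rGamma (c + (RtoC (INR n) + 1))).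
  set (A := a + RtoC (INR n)) in *. set (B := b + RtoC (INR n)) in *.
  set (c' := c + RtoC (INR n)) in *.
  replace (1 + RtoC (INR n)) with (RtoC (INR n) + 1) in * by ring.
  set (m := RtoC (INR n) + 1) in *.
  replace (h * (A * B / (2 * m)) * g) with ((A / m) * (B / c') * / 2 * (h * (c' * g)))
    by (field; auto).
  rewrite Cmod_mult. apply Rmult_le_compat_r; [apply Cmod_ge_0|].
  rewrite !Cmod_mult, Cmod_inv, !Cmod_div, Cmod_R, Rabs_pos_eq; auto using two_neq_0; try lra.
  apply Cmod_gt_0 in B1, B2.
  assert (Q1 : (Cmod A / Cmod m <= 5 / 4)%R).
  { apply Rmult_le_reg_r with (Cmod m); auto. unfold Rdiv at 1.
    rewrite Rmult_assoc, Rinv_l by lra. lra. }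
  assert (Q2 : (Cmod B / Cmod c' <= 5 / 4)%R).
  { apply Rmult_le_reg_r with (Cmod c'); auto. unfold Rdiv at 1.
    rewrite Rmult_assoc, Rinv_l by lra. lra. }
  assert (R1 : (0 <= Cmod A / Cmod m)%R)
    by (apply Rmult_le_pos; [apply Cmod_ge_0 | left; now apply Rinv_0_lt_compat]).
  assert (R2 : (0 <= Cmod B / Cmod c')%R)
    by (apply Rmult_le_pos; [apply Cmod_ge_0 | left; now apply Rinv_0_lt_compat]).
  nra.
Qed.

Lemma regF_has_sum (a b c : C) :
  has_sum (fun n => hterm a b n * rGamma (c + RtoC (INR n))) (regF a b c).
Proof.
  apply geo_has_sum. destruct (regF_bound a b c) as (M & HM & H).
  exists M, (25 / 32)%R. repeat split; auto; lra.
Qed.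

(** Boundary terms of the telescoping arguments carry a linear factor. By Bernoulli's inequality
    [n <= 4 * (5/4)^n], and [5/4 * 25/32 = 125/128] is still below 1. *)
Lemma regF_linear_lim (k a b c : C) :
  clim (fun n => (k + RtoC (INR n)) * (hterm a b n * rGamma (c + RtoC (INR n)))) 0.
Proof.
  apply geo_clim_0. destruct (regF_bound a b c) as (M & HM & H).
  exists ((Cmod k + 4) * M)%R, (125 / 128)%R.
  assert (Pk := Cmod_ge_0 k).
  repeat split; try lra.
  - apply Rmult_le_pos; lra.
  - intros n. rewrite Cmod_mult.
    replace (125 / 128)%R with (5 / 4 * (25 / 32))%R by lra.
    rewrite Rpow_mult_distr.
    replace ((Cmod k + 4) * M * ((5 / 4) ^ n * (25 / 32) ^ n))%R
      with (((Cmod k + 4) * (5 / 4) ^ n) * (M * (25 / 32) ^ n))%R by ring.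
    apply Rmult_le_compat; auto using Cmod_ge_0.
    eapply Rle_trans; [apply Cmod_triangle|]. rewrite Cmod_INR.
    assert (B := poly n (1 / 4) ltac:(lra)).
    replace (1 + 1 / 4)%R with (5 / 4)%R in B by lra.
    assert (P := pos_INR n). nra.
Qed.

(** * Contiguity relations and Bailey's theorem *)

(** It holds term by term: [E (E + 1)_n = (E)_n (E + n)], and [E + n = (c + n) - (c - E)]. *)
Lemma regF_contiguous_E (q E c : C) :
  E * regF q (E + 1) (c + 1) = regF q E c - (c - E) * regF q E (c + 1).
Proof.
  apply clim_unique with
    (fun N => csum N (fun n => E * (hterm q (E + 1) n * rGamma (c + 1 + RtoC (INR n))))).
  - apply has_sum_scal, regF_has_sum.
  - apply (has_sum_ext (fun n => hterm q E n * rGamma (c + RtoC (INR n))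
             - (c - E) * (hterm q E n * rGamma (c + 1 + RtoC (INR n))))).
    + intros n. rewrite (rGamma_succ (c + RtoC (INR n))).
      replace (c + RtoC (INR n) + 1) with (c + 1 + RtoC (INR n)) by ring.
      assert (P : E * poch (E + 1) n = poch E n * (E + RtoC (INR n)))
        by (rewrite <- poch_S_l; reflexivity).
      unfold hterm.
      replace (E * (poch q n * poch (E + 1) n / RtoC (INR (fact n)) * (/ 2) ^ n *
                    rGamma (c + 1 + RtoC (INR n))))
        with (poch q n * (E * poch (E + 1) n) / RtoC (INR (fact n)) * (/ 2) ^ n *
                    rGamma (c + 1 + RtoC (INR n)))
        by (unfold Cdiv; ring).
      rewrite P. field. auto using RtoC_INR_fact_neq_0.
    + apply has_sum_minus; [|apply has_sum_scal]; apply regF_has_sum.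
Qed.

(* Gosper's algorithm gives the antidifference [-(E + m) hterm (p+1) E m rGamma (c+m+1)] at [m + 1]. *)
Lemma regF_contiguous_q (p E c : C) :
  2 * regF p E c = regF (p + 1) E c + (c - E) * regF (p + 1) E (c + 1).
Proof.
  set (g := fun n => match n with
     | O => RtoC 0
     | S m => - ((E + RtoC (INR m)) * (hterm (p + 1) E m * rGamma (c + 1 + RtoC (INR m))))
     end).
  assert (Hg : clim g 0).
  { apply clim_incr_1. simpl.
    apply clim_ext with (fun n => (-1) * ((E + RtoC (INR n))
       * (hterm (p + 1) E n * rGamma (c + 1 + RtoC (INR n))))); [intros; ring|].
    replace (RtoC 0) with ((-1) * 0) by ring. apply clim_scal, regF_linear_lim. }
  assert (T := has_sum_telescope g eq_refl Hg).
  assert (S1 := has_sum_plus _ _ _ _ (regF_has_sum (p + 1) E c)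
     (has_sum_scal (c - E) _ _ (regF_has_sum (p + 1) E (c + 1)))).
  assert (S2 := has_sum_minus _ _ _ _ S1 (has_sum_scal 2 _ _ (regF_has_sum p E c))).
  assert (Z : regF (p + 1) E c + (c - E) * regF (p + 1) E (c + 1) - 2 * regF p E c = 0).
  { apply (clim_unique _ _ _ S2). apply (has_sum_ext _ _ _) with (2 := T). intros [|m].
    - cbv beta. rewrite !hterm_0, (rGamma_succ (c + RtoC (INR 0))). simpl. rewrite hterm_0.
      replace (c + 0 + 1) with (c + 1 + 0) by ring. ring.
    - cbv beta. unfold g.
      rewrite (rGamma_succ (c + RtoC (INR (S m)))), (rGamma_succ (c + 1 + RtoC (INR m))), !RtoC_INR_S.
      replace (c + (RtoC (INR m) + 1) + 1) with (c + 1 + (RtoC (INR m) + 1)) by ring.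
      replace (c + 1 + RtoC (INR m) + 1) with (c + 1 + (RtoC (INR m) + 1)) by ring.
      unfold hterm. rewrite (poch_S_l p m), RtoC_INR_fact_S. simpl.
      field. repeat split; auto using RtoC_INR_fact_neq_0, RtoC_INR_S_neq_0. }
  symmetry. apply Ceq_minus. exact Z.
Qed.

Lemma regF_bailey_step (a c : C) :
  regF a (1 - a) c = (c + a) * (c + 1 - a) * regF a (1 - a) (c + 2).
Proof.
  (* An antidifference of the termwise difference of the two sides. It rests on [(c+n)(c+1+n) -
     (c+a)(c+1-a) = 2n(c+1+n) - (a+n)(1-a+n)], where the second upper parameter [1 - a] is
     essential. The [0 +] matches [regF_linear_lim]. *)
  set (g := fun n => (-2) * ((0 + RtoC (INR n))
              * (hterm a (1 - a) n * rGamma (c + 1 + RtoC (INR n))))).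
  assert (Hg : clim g 0).
  { replace (RtoC 0) with ((-2) * 0) by ring. apply clim_scal, regF_linear_lim. }
  assert (Hg0 : g O = 0) by (unfold g; simpl; ring).
  assert (T := has_sum_telescope g Hg0 Hg).
  assert (S := has_sum_minus _ _ _ _ (regF_has_sum a (1 - a) c)
     (has_sum_scal ((c + a) * (c + 1 - a)) _ _ (regF_has_sum a (1 - a) (c + 2)))).
  apply Ceq_minus. apply (clim_unique _ _ _ S). apply (has_sum_ext _ _ _) with (2 := T).
  intros n. cbv beta. unfold g. rewrite hterm_S, RtoC_INR_S.
  rewrite (rGamma_succ (c + RtoC (INR n))).
  replace (c + RtoC (INR n) + 1) with (c + 1 + RtoC (INR n)) by ring.
  rewrite (rGamma_succ (c + 1 + RtoC (INR n))).
  replace (c + 1 + RtoC (INR n) + 1) with (c + 2 + RtoC (INR n)) by ring.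
  replace (c + 1 + (RtoC (INR n) + 1)) with (c + 2 + RtoC (INR n)) by ring.
  field. apply RtoC_INR_S_neq_0.
Qed.

Lemma hypF_geo (a b c : C) : ~ nonpos_int c -> geo (fun n => hterm a b n / poch c n).
Proof.
  intros Hc. assert (N := rGamma_neq_0 c Hc).
  apply geo_ext with (fun n => / rGamma c * (hterm a b n * rGamma (c + RtoC (INR n)))).
  - intros n. rewrite (rGamma_add c n) in *. field.
    split; auto using poch_neq_0. intros E. apply N. rewrite E. ring.
  - apply geo_scal. destruct (regF_bound a b c) as (M & HM & H).
    exists M, (25 / 32)%R. repeat split; auto; lra.
Qed.

Lemma hypF_has_sum (a b c : C) :
  ~ nonpos_int c -> has_sum (fun n => hterm a b n / poch c n) (hypF a b c).
Proof. intros Hc. now apply geo_has_sum, hypF_geo. Qed.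

Lemma regF_hypF (a b c : C) : ~ nonpos_int c -> regF a b c = rGamma c * hypF a b c.
Proof.
  intros Hc. unfold regF, hypF. rewrite <- cseries_scal by now apply hypF_geo.
  apply cseries_ext. intros n. rewrite (rGamma_add c n). field. now apply poch_neq_0.
Qed.

Lemma hterm_fact_bound (a b : C) :
  exists M, (0 <= M)%R /\
    forall n, (Cmod (hterm a b n / RtoC (INR (fact n))) <= M * (25 / 32) ^ n)%R.
Proof.
  destruct (poch_fact_bound a) as (M1 & P1 & H1).
  destruct (poch_fact_bound b) as (M2 & P2 & H2).
  exists (M1 * M2)%R. split; [now apply Rmult_le_pos|]. intros n.
  replace (hterm a b n / RtoC (INR (fact n)))
    with (poch a n / RtoC (INR (fact n)) * (poch b n / RtoC (INR (fact n))) * (/ 2) ^ n)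
    by (unfold hterm, Cdiv; ring).
  rewrite !Cmod_mult, Cmod_half_pow.
  replace (25 / 32)%R with (5 / 4 * (5 / 4) * / 2)%R by lra.
  rewrite !Rpow_mult_distr.
  replace (M1 * M2 * ((5 / 4) ^ n * (5 / 4) ^ n * (/ 2) ^ n))%R
    with ((M1 * (5 / 4) ^ n) * (M2 * (5 / 4) ^ n) * (/ 2) ^ n)%R by ring.
  apply Rmult_le_compat_r; [apply pow_le; lra|].
  apply Rmult_le_compat; auto using Cmod_ge_0.
Qed.

Lemma Cmod_ge_re (z : C) : (Re z <= Cmod z)%R.
Proof. eapply Rle_trans; [apply Rle_abs | apply re_le_Cmod]. Qed.

(** The first factor has modulus at least [Re c], and the factor [c + k] at least [k + 1]. Keeping
    [Re c] apart produces the decay in [hypF_near_1]. *)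
Lemma poch_lower_bound (c : C) (n : nat) :
  (1 <= Re c)%R -> (Re c * INR (fact (S n)) <= Cmod (poch c (S n)))%R.
Proof.
  intros Hc. induction n as [|n IH].
  - simpl. rewrite Cmult_1_l, Rmult_1_r.
    replace (c + 0) with c by ring. apply Cmod_ge_re.
  - change (poch c (S (S n))) with (poch c (S n) * (c + RtoC (INR (S n)))).
    rewrite Cmod_mult, (fact_simpl (S n)), mult_INR.
    assert (A := Cmod_ge_re (c + RtoC (INR (S n)))). rewrite re_plus, re_RtoC in A.
    rewrite (S_INR (S n)).
    replace (Re c * ((INR (S n) + 1) * INR (fact (S n))))%R
      with (Re c * INR (fact (S n)) * (INR (S n) + 1))%R by ring.
    assert (P := pos_INR (S n)). assert (Q := pos_INR (fact (S n))).
    apply Rmult_le_compat; auto; nra.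
Qed.

Lemma nonpos_int_re_pos (c : C) : (0 < Re c)%R -> ~ nonpos_int c.
Proof. intros H [k E]. rewrite E, re_RtoC in H. assert (P := pos_INR k). lra. Qed.

(** [M] does not depend on [c]: by [poch_lower_bound] every term after the first is at most
    [1 / Re c] times the modulus of the geometrically small [hterm a b n / n!]. *)
Lemma hypF_near_1 (a b : C) :
  exists M, forall c, (1 <= Re c)%R -> (Cmod (hypF a b c - 1) <= M / Re c)%R.
Proof.
  destruct (hterm_fact_bound a b) as (M & HM & H).
  exists (M / (1 - 25 / 32))%R. intros c Hc.
  assert (Nc : ~ nonpos_int c) by (apply nonpos_int_re_pos; lra).
  apply (Cmod_lim_le _ _ 1 _ 1 (hypF_has_sum a b c Nc)).
  intros [|n] Hn; [lia|].
  rewrite csum_first, hterm_0. simpl poch at 1.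
  replace (1 / 1 + csum n (fun k => hterm a b (S k) / poch c (S k)) - 1)
    with (csum n (fun k => hterm a b (S k) / poch c (S k))) by field.
  replace (M / (1 - 25 / 32) / Re c)%R with ((M / Re c) / (1 - 25 / 32))%R by (field; lra).
  apply (csum_Cmod_geom 1 n (fun k => hterm a b k / poch c k)).
  - apply Rmult_le_pos; auto. left; apply Rinv_0_lt_compat; lra.
  - lra.
  - intros j. change (1 + j)%nat with (S j).
    assert (B := poch_lower_bound c j Hc).
    assert (Pf : (0 < INR (fact (S j)))%R) by (apply lt_0_INR, lt_O_fact).
    assert (G := H (S j)).
    rewrite Cmod_div in G by apply RtoC_INR_fact_neq_0. rewrite Cmod_INR in G.
    rewrite Cmod_div by now apply poch_neq_0.
    assert (Ph := Cmod_ge_0 (hterm a b (S j))).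
    apply Rle_trans with (Cmod (hterm a b (S j)) / (Re c * INR (fact (S j))))%R.
    + unfold Rdiv. apply Rmult_le_compat_l; auto. apply Rinv_le_contravar; auto.
      apply Rmult_lt_0_compat; lra.
    + replace (Cmod (hterm a b (S j)) / (Re c * INR (fact (S j))))%R
        with (/ Re c * (Cmod (hterm a b (S j)) / INR (fact (S j))))%R by (field; lra).
      replace (M / Re c * (25 / 32) ^ j)%R with (/ Re c * (M * (25 / 32) ^ j))%R by (field; lra).
      apply Rmult_le_compat_l; [left; apply Rinv_0_lt_compat; lra|].
      eapply Rle_trans; [exact G|]. apply Rmult_le_compat_l; auto.
      simpl. assert (P := pow_le (25 / 32) j ltac:(lra)). lra.
Qed.

Lemma hypF_lim_1 (a b c : C) : clim (fun n => hypF a b (c + RtoC (INR (2 * n)))) 1.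
Proof.
  destruct (hypF_near_1 a b) as [M H].
  apply clim_eps. intros eps He.
  destruct (nfloor_ex (Rabs (Re c) + 1 + Rabs M / eps)) as [N HN].
  { assert (A := Rabs_pos (Re c)).
    assert (0 <= Rabs M / eps)%R; [|lra].
    apply Rmult_le_pos; [apply Rabs_pos | left; now apply Rinv_0_lt_compat]. }
  exists (S N). intros n Hn.
  apply le_INR in Hn. rewrite S_INR in Hn.
  assert (E : Re (c + RtoC (INR (2 * n))) = (Re c + 2 * INR n)%R).
  { rewrite re_plus, re_RtoC, mult_INR. simpl. ring. }
  assert (A := Rle_abs (- Re c)). rewrite Rabs_Ropp in A.
  assert (Q : (0 <= Rabs M / eps)%R)
    by (apply Rmult_le_pos; [apply Rabs_pos | left; now apply Rinv_0_lt_compat]).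
  assert (P := Rabs_pos (Re c)).
  assert (L : (Rabs M / eps < Re c + 2 * INR n)%R) by lra.
  assert (L1 : (1 <= Re c + 2 * INR n)%R) by lra.
  specialize (H (c + RtoC (INR (2 * n)))). rewrite E in H. specialize (H L1).
  eapply Rle_lt_trans; [exact H|].
  apply Rmult_lt_reg_r with (Re c + 2 * INR n)%R; [lra|].
  unfold Rdiv. rewrite Rmult_assoc, Rinv_l by lra.
  assert (B := Rle_abs M).
  apply Rmult_lt_compat_l with (r := eps) in L; auto.
  replace (eps * (Rabs M / eps))%R with (Rabs M) in L by (field; lra). lra.
Qed.

Lemma regF_bailey_iter (a c : C) (n : nat) :
  regF a (1 - a) c
  = 4 ^ n * poch ((c + a) / 2) n * poch ((c + 1 - a) / 2) n
    * regF a (1 - a) (c + RtoC (INR (2 * n))).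
Proof.
  induction n as [|n IH].
  - simpl. replace (c + 0) with c by ring. ring.
  - rewrite IH, (regF_bailey_step a (c + RtoC (INR (2 * n)))).
    replace (2 * S n)%nat with (S (S (2 * n))) by lia.
    rewrite !RtoC_INR_S.
    replace (c + (RtoC (INR (2 * n)) + 1 + 1)) with (c + RtoC (INR (2 * n)) + 2) by ring.
    rewrite mult_INR, RtoC_mult.
    replace (INR 2) with 2%R by (simpl; ring).
    simpl poch. rewrite Cpow_S. field.
Qed.

(** [rGamma_add] with [poch_double] yields for [rGamma c] the same power of 4 as [regF_bailey_iter]
    yields for [regF]. Cross multiplication cancels it together with [rGamma (c + 2n + 2)], leaving
    Gauss sequences and one [hypF] that tends to 1. *)
Lemma regF_bailey_ordinary (a c : C) :
  ~ nonpos_int c ->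
  regF a (1 - a) c * (rGamma (c / 2) * rGamma ((c + 1) / 2))
  = rGamma c * (rGamma ((c + a) / 2) * rGamma ((c + 1 - a) / 2)).
Proof.
  intros Hc.
  assert (E : forall n,
    regF a (1 - a) c * (rgauss_seq (c / 2) n * rgauss_seq ((c + 1) / 2) n)
    = rGamma c * (rgauss_seq ((c + a) / 2) n * rgauss_seq ((c + 1 - a) / 2) n
                  * hypF a (1 - a) (c + RtoC (INR (2 * S n))))).
  { intros n.
    assert (B := regF_bailey_iter a c (S n)).
    rewrite (regF_hypF _ _ (c + RtoC (INR (2 * S n)))) in B by now apply nonpos_int_shift.
    assert (G := rGamma_add c (2 * S n)). rewrite poch_double in G.
    assert (Nf := RtoC_INR_fact_neq_0 n).
    set (X := cpowR (INR n) (c / 2) * cpowR (INR n) ((c + 1) / 2)).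
    assert (NX : X <> 0) by (apply Cmult_neq_0; apply cpowR_neq_0).
    (* Both pairs of arguments have the same sum [c + 1/2], so the powers of [n] in the Gauss
       sequences balance. *)
    assert (EX : cpowR (INR n) ((c + a) / 2) * cpowR (INR n) ((c + 1 - a) / 2) = X).
    { unfold X. rewrite <- !cpowR_plus. f_equal. field. }
    assert (N2 : RtoC (INR (fact n)) * RtoC (INR (fact n)) * X <> 0)
      by auto using Cmult_neq_0.
    assert (K : forall u v : C, u * (RtoC (INR (fact n)) * RtoC (INR (fact n)) * X)
                  = v * (RtoC (INR (fact n)) * RtoC (INR (fact n)) * X) -> u = v).
    { intros u v Huv.
      replace u with (u * (RtoC (INR (fact n)) * RtoC (INR (fact n)) * X)
        / (RtoC (INR (fact n)) * RtoC (INR (fact n)) * X)) by (now field).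
      rewrite Huv. now field. }
    apply K.
    transitivity (regF a (1 - a) c * (poch (c / 2) (S n) * poch ((c + 1) / 2) (S n))).
    - rewrite !poch_rgauss. unfold X. ring.
    - rewrite B, G.
      transitivity (4 ^ S n * poch (c / 2) (S n) * poch ((c + 1) / 2) (S n)
         * rGamma (c + RtoC (INR (2 * S n)))
         * (poch ((c + a) / 2) (S n) * poch ((c + 1 - a) / 2) (S n))
         * hypF a (1 - a) (c + RtoC (INR (2 * S n)))); [ring|].
      rewrite (poch_rgauss ((c + a) / 2)), (poch_rgauss ((c + 1 - a) / 2)), <- EX. ring. }
  apply clim_unique with
    (fun n => regF a (1 - a) c * (rgauss_seq (c / 2) n * rgauss_seq ((c + 1) / 2) n)).
  - apply clim_scal, clim_mult; apply rGamma_clim.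
  - eapply clim_ext; [intros n; symmetry; apply E|].
    apply clim_scal.
    replace (rGamma ((c + a) / 2) * rGamma ((c + 1 - a) / 2))
      with (rGamma ((c + a) / 2) * rGamma ((c + 1 - a) / 2) * 1) by ring.
    apply clim_mult; [apply clim_mult; apply rGamma_clim|].
    apply (clim_incr_1 (fun n => hypF a (1 - a) (c + RtoC (INR (2 * n))))), hypF_lim_1.
Qed.

Lemma cpowR_2_2 (z : C) : cpowR 2 (z + 2) = 4 * cpowR 2 z.
Proof.
  replace (z + 2) with (z + 1 + 1) by ring. rewrite !cpowR_plus, cpowR_1 by lra. ring.
Qed.

(** Duplication turns the half-argument factors into a multiple of [rGamma c], which cancels for
    ordinary [c]. What remains has no singular factor in [c] and so extends to every [c]. *)
Lemma regF_bailey (a c : C) :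
  regF a (1 - a) c * (cpowR 2 c * rGamma (1 / 2))
  = 2 * (rGamma ((c + a) / 2) * rGamma ((c + 1 - a) / 2)).
Proof.
  assert (Hord : forall c, ~ nonpos_int c ->
    regF a (1 - a) c * (cpowR 2 c * rGamma (1 / 2))
    = 2 * (rGamma ((c + a) / 2) * rGamma ((c + 1 - a) / 2))).
  { clear c. intros c Hc. assert (N := rGamma_neq_0 c Hc).
    assert (B := regF_bailey_ordinary a c Hc). assert (D := rGamma_duplication c).
    transitivity (2 * (regF a (1 - a) c * (rGamma (c / 2) * rGamma ((c + 1) / 2))) / rGamma c).
    - replace (2 * (regF a (1 - a) c * (rGamma (c / 2) * rGamma ((c + 1) / 2))))
        with (regF a (1 - a) c * (2 * (rGamma (c / 2) * rGamma ((c + 1) / 2)))) by ring.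
      rewrite D. now field.
    - rewrite B. now field. }
  (* The right-hand side satisfies the recurrence of [regF_bailey_step], which descends to the poles. *)
  destruct (nfloor_ex (Rabs (Re c))) as [N HN]; [apply Rabs_pos|].
  assert (HN' : ~ nonpos_int (c + RtoC (INR (2 * S N)))).
  { apply nonpos_int_re_pos. rewrite re_plus, re_RtoC, mult_INR, (S_INR N).
    replace (INR 2) with 2%R by (simpl; ring).
    assert (A := Rle_abs (- Re c)). rewrite Rabs_Ropp in A. assert (P := pos_INR N). lra. }
  revert HN'. generalize (S N). clear N HN. intros n. revert c.
  induction n as [|n IH]; intros c Hc.
  - apply Hord. simpl in Hc. now replace (c + 0) with c in Hc by ring.
  - rewrite regF_bailey_step.
    assert (I : ~ nonpos_int (c + 2 + RtoC (INR (2 * n)))).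
    { replace (2 * S n)%nat with (2 + 2 * n)%nat in Hc by lia.
      rewrite RtoC_INR_add in Hc. replace (INR 2) with 2%R in Hc by (simpl; ring).
      now replace (c + 2 + RtoC (INR (2 * n))) with (c + (2 + RtoC (INR (2 * n)))) by ring. }
    specialize (IH (c + 2) I). rewrite cpowR_2_2 in IH.
    rewrite (rGamma_succ ((c + a) / 2)), (rGamma_succ ((c + 1 - a) / 2)).
    replace ((c + a) / 2 + 1) with ((c + 2 + a) / 2) by field.
    replace ((c + 1 - a) / 2 + 1) with ((c + 2 + 1 - a) / 2) by field.
    transitivity ((c + a) * (c + 1 - a) / 4
      * (regF a (1 - a) (c + 2) * (4 * cpowR 2 c * rGamma (1 / 2)))); [field|].
    rewrite IH. field.
Qed.

Lemma nonpos_int_half : ~ nonpos_int (1 / 2).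
Proof.
  replace (1 / 2) with (RtoC (1 / 2)) by (rewrite RtoC_div; [reflexivity | lra]).
  apply nonpos_int_re_pos. rewrite re_RtoC. lra.
Qed.

(** Duplication at [c + a - 1] trades [rGamma ((c + a) / 2)] for a quotient with
    [Gamma ((c + a - 1) / 2)], the shape of the summands in the final sums. *)
Lemma regF_bailey_Gamma (a c : C) :
  ~ nonpos_int ((c + a - 1) / 2) ->
  regF a (1 - a) c
  = cpowR 2 (a - 1) * rGamma (c + a - 1) * Gamma ((c + a - 1) / 2) * rGamma ((c + 1 - a) / 2).
Proof.
  intros Hn. rewrite (Gamma_rGamma _ Hn).
  assert (N := rGamma_neq_0 _ Hn). assert (N2 := rGamma_neq_0 _ nonpos_int_half).
  assert (N3 := cpowR_neq_0 2 c).
  assert (B := regF_bailey a c). assert (D := rGamma_duplication (c + a - 1)).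
  replace ((c + a - 1 + 1) / 2) with ((c + a) / 2) in D by field.
  assert (P : cpowR 2 (c + a - 1) = cpowR 2 c * cpowR 2 (a - 1)).
  { rewrite <- cpowR_plus. f_equal. ring. }
  rewrite P in D.
  transitivity (regF a (1 - a) c * (cpowR 2 c * rGamma (1 / 2)) / (cpowR 2 c * rGamma (1 / 2)));
    [now field|].
  rewrite B.
  transitivity (2 * (rGamma ((c + a - 1) / 2) * rGamma ((c + a) / 2)) * rGamma ((c + 1 - a) / 2)
     / (rGamma ((c + a - 1) / 2) * (cpowR 2 c * rGamma (1 / 2)))); [now field|].
  rewrite D. now field.
Qed.

(** * Binomial sums *)

(** Unlike [Binomial.C], a quotient of factorials with truncated subtraction, this vanishes for
    [k > n], so Pascal's rule needs no side condition. *)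
Fixpoint pasc (n k : nat) : R :=
  match n, k with
  | _, O => 1
  | O, S _ => 0
  | S n', S k' => pasc n' k' + pasc n' (S k')
  end.

Lemma pasc_0_r (n : nat) : pasc n 0 = 1%R.
Proof. now destruct n. Qed.

Lemma pasc_gt (n k : nat) : (n < k)%nat -> pasc n k = 0%R.
Proof.
  revert k. induction n as [|n IH]; intros [|k] H; try lia; [reflexivity|].
  simpl. rewrite !IH by lia. ring.
Qed.

Lemma pasc_binomial (n k : nat) : (k <= n)%nat -> pasc n k = Binomial.C n k.
Proof.
  revert k. induction n as [|n IH]; intros [|k] H.
  - symmetry. apply C_n_0.
  - lia.
  - symmetry. apply C_n_0.
  - destruct (Nat.eq_dec k n) as [->|Hk].
    + simpl. rewrite IH, pasc_gt, !C_n_n by lia. ring.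
    + simpl. rewrite !IH by lia. apply pascal. lia.
Qed.

Lemma pasc_fact (n k : nat) :
  (k <= n)%nat ->
  RtoC (pasc n k) = RtoC (INR (fact n)) / (RtoC (INR (fact k)) * RtoC (INR (fact (n - k)))).
Proof.
  intros H. rewrite pasc_binomial by assumption. unfold Binomial.C.
  rewrite RtoC_div, RtoC_mult; [reflexivity|].
  apply Rmult_integral_contrapositive_currified; apply INR_fact_neq_0.
Qed.

(** The induction step shared by all binomial sums below. *)
Lemma csum_pascal (n : nat) (f : nat -> C) :
  csum (S (S n)) (fun j => RtoC (pasc (S n) j) * f j)
  = csum (S n) (fun j => RtoC (pasc n j) * (f j + f (S j))).
Proof.
  rewrite csum_first, pasc_0_r.
  rewrite (csum_ext (S n) (fun k => RtoC (pasc (S n) (S k)) * f (S k))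
    (fun k => RtoC (pasc n k) * f (S k) + RtoC (pasc n (S k)) * f (S k)))
    by (intros k _; simpl; rewrite RtoC_plus; ring).
  rewrite (csum_ext (S n) (fun j => RtoC (pasc n j) * (f j + f (S j)))
    (fun j => RtoC (pasc n j) * f j + RtoC (pasc n j) * f (S j)))
    by (intros k _; ring).
  rewrite !csum_plus.
  assert (A := csum_first (S n) (fun k => RtoC (pasc n k) * f k)).
  change (csum (S (S n)) (fun k => RtoC (pasc n k) * f k))
    with (csum (S n) (fun k => RtoC (pasc n k) * f k) + RtoC (pasc n (S n)) * f (S n)) in A.
  rewrite pasc_gt, pasc_0_r in A by lia.
  replace (csum (S n) (fun k => RtoC (pasc n k) * f k))
    with (1 * f O + csum (S n) (fun k => RtoC (pasc n (S k)) * f (S k)))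
    by (rewrite <- A; ring).
  ring.
Qed.

(** Each row is [1 + s T] applied to the previous one, [T] being the shift in [r]; the sum expands
    [(1 + s T)^i]. *)
Lemma binomial_table (s : C) (Y : nat -> nat -> C) :
  forall i r,
  (forall k r, (k < i)%nat -> Y (S k) r = Y k r + s * Y k (S r)) ->
  Y i r = csum (S i) (fun j => RtoC (pasc i j) * (s ^ j * Y O (r + j)%nat)).
Proof.
  induction i as [|i IH]; intros r H.
  - simpl. rewrite Nat.add_0_r. ring.
  - rewrite csum_pascal, H by lia.
    rewrite (IH r), (IH (S r)) by (intros; apply H; lia).
    rewrite <- csum_scal, <- csum_plus. apply csum_ext. intros j _.
    rewrite Nat.add_succ_r. simpl. ring.
Qed.

(** After [csum_pascal] the two neighbouring terms combine through
    [(a + j) + (b + k - j) = a + b + k]. *)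
Lemma chu_vandermonde (a b : C) (k : nat) :
  csum (S k) (fun j => RtoC (pasc k j) * (poch a j * poch b (k - j))) = poch (a + b) k.
Proof.
  induction k as [|k IH]; [simpl; ring|].
  rewrite csum_pascal. simpl poch at 5. rewrite <- IH, Cmult_comm, <- csum_scal.
  apply csum_ext. intros j Hj.
  replace (S k - j)%nat with (S (k - j)) by lia.
  replace (S k - S j)%nat with (k - j)%nat by lia.
  assert (Ek : RtoC (INR k) = RtoC (INR j) + RtoC (INR (k - j)))
    by (rewrite <- RtoC_INR_add; do 2 f_equal; lia).
  rewrite Ek. simpl. ring.
Qed.

Lemma chu_vandermonde_fact (a b : C) (k : nat) :
  csum (S k) (fun j => poch a j / RtoC (INR (fact j))
                       * (poch b (k - j) / RtoC (INR (fact (k - j)))))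
  = poch (a + b) k / RtoC (INR (fact k)).
Proof.
  rewrite <- chu_vandermonde. unfold Cdiv at 3. rewrite Cmult_comm, <- csum_scal.
  apply csum_ext. intros j Hj. rewrite pasc_fact by lia.
  field. repeat split; apply RtoC_INR_fact_neq_0.
Qed.

(** * The binomial series at 1/2 *)

(** The terms of [(1 - x)^(-l)] at [x = 1/2]. *)
Definition bterm (l : C) (n : nat) : C := poch l n / RtoC (INR (fact n)) * (/ 2) ^ n.

Lemma bterm_bound (l : C) :
  exists M, (0 <= M)%R /\ forall n, (Cmod (bterm l n) <= M * (5 / 8) ^ n)%R.
Proof.
  destruct (poch_fact_bound l) as (M & HM & H). exists M. split; auto. intros n.
  unfold bterm. rewrite Cmod_mult, Cmod_half_pow.
  replace (5 / 8)%R with (5 / 4 * / 2)%R by lra.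
  rewrite Rpow_mult_distr, <- Rmult_assoc.
  apply Rmult_le_compat_r; [apply pow_le; lra | apply H].
Qed.

Lemma bterm_geo (l : C) : geo (bterm l).
Proof.
  destruct (bterm_bound l) as (M & HM & H). exists M, (5 / 8)%R. repeat split; auto; lra.
Qed.

Lemma bterm_convolution (a b : C) (k : nat) :
  csum (S k) (fun j => bterm a j * bterm b (k - j)) = bterm (a + b) k.
Proof.
  unfold bterm. rewrite <- chu_vandermonde_fact, Cmult_comm, <- csum_scal.
  apply csum_ext. intros j Hj.
  replace ((/ 2) ^ k) with ((/ 2) ^ j * (/ 2) ^ (k - j)); [ring|].
  rewrite <- Cpow_add_r. f_equal. lia.
Qed.

(* The case [c = a] of Bailey's theorem. *)
Lemma binomial_series_ordinary (l : C) : ~ nonpos_int (1 - l) -> cseries (bterm l) = cpowR 2 l.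
Proof.
  intros Hl. set (a := 1 - l) in *.
  assert (N := rGamma_neq_0 a Hl). assert (N2 := rGamma_neq_0 _ nonpos_int_half).
  assert (B := regF_bailey a a). rewrite regF_hypF in B by assumption.
  replace ((a + a) / 2) with a in B by field.
  replace ((a + 1 - a) / 2) with (1 / 2) in B by field.
  replace (1 - a) with l in B by (unfold a; ring).
  assert (E : hypF a l a = cseries (bterm l)).
  { unfold hypF. apply cseries_ext. intros n. unfold hterm, bterm.
    field. split; auto using poch_neq_0, RtoC_INR_fact_neq_0. }
  rewrite E in B.
  assert (P : cpowR 2 l * cpowR 2 a = 2).
  { rewrite <- cpowR_plus. unfold a. replace (l + (1 - l)) with (RtoC 1) by ring.
    apply cpowR_1. lra. }
  assert (N3 := cpowR_neq_0 2 a).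
  transitivity (rGamma a * cseries (bterm l) * (cpowR 2 a * rGamma (1 / 2))
                / (rGamma a * cpowR 2 a * rGamma (1 / 2))); [now field|].
  rewrite B. transitivity (cpowR 2 l * cpowR 2 a / cpowR 2 a); [rewrite P|]; now field.
Qed.

Lemma half_integer_ordinary (k : nat) : ~ nonpos_int (RtoC (/ 2 - INR k)).
Proof.
  intros [m E]. injection E as E.
  assert (H : (1 + 2 * INR m = 2 * INR k)%R) by lra.
  rewrite !INR_IZR_INZ in H.
  rewrite <- !mult_IZR, <- plus_IZR in H. apply eq_IZR in H. lia.
Qed.

Lemma binomial_series (l : C) : cseries (bterm l) = cpowR 2 l.
Proof.
  destruct (classic (nonpos_int (1 - l))) as [[k Hk]|H]; [|now apply binomial_series_ordinary].
  (* Here [l] is a positive integer, excluded from the ordinary case. Splitting off [1/2] leaves two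
     half-integer exponents, both of which are ordinary. *)
  assert (E : cseries (bterm l) = cseries (bterm (/ 2)) * cseries (bterm (l - / 2))).
  { apply cseries_unique.
    apply (has_sum_ext (fun k => csum (S k) (fun j => bterm (/ 2) j * bterm (l - / 2) (k - j)))).
    - intros n. rewrite bterm_convolution. f_equal. ring.
    - apply has_sum_cauchy_product; apply bterm_geo. }
  assert (E2 : (/ 2 : C) = RtoC (/ 2)) by (rewrite RtoC_inv; [reflexivity | lra]).
  rewrite E, !binomial_series_ordinary.
  - rewrite <- cpowR_plus. f_equal. ring.
  - replace (1 - (l - / 2)) with (RtoC (/ 2 - INR k)); [apply half_integer_ordinary|].
    rewrite RtoC_minus, <- E2.
    replace (RtoC (INR k)) with (- (1 - l)) by (rewrite Hk, RtoC_opp; ring). field.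
  - replace (1 - / 2) with (RtoC (/ 2 - INR 0)); [apply half_integer_ordinary|].
    rewrite RtoC_minus, <- E2. simpl. field.
Qed.

(** * Euler's transformation *)

(** The coefficient identity behind Euler's transformation. Both sides satisfy the recurrence [(k +
    1)(c + k) S_(k+1) = (c - x + k)(c - y + k) S_k]. *)
Lemma pfaff_saalschutz (x y c : C) (k : nat) :
  ~ nonpos_int c ->
  csum (S k) (fun j => poch x j * poch y j / (poch c j * RtoC (INR (fact j)))
                       * (poch (c - x - y) (k - j) / RtoC (INR (fact (k - j)))))
  = poch (c - x) k * poch (c - y) k / (poch c k * RtoC (INR (fact k))).
Proof.
  intros Hc. induction k as [|k IH]; [simpl; field|].
  set (s := c - x - y) in *.
  set (t := fun k j => poch x j * poch y j / (poch c j * RtoC (INR (fact j)))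
                       * (poch s (k - j) / RtoC (INR (fact (k - j))))) in *.
  change (csum (S (S k)) (t (S k)) = poch (c - x) (S k) * poch (c - y) (S k)
            / (poch c (S k) * RtoC (INR (fact (S k))))).
  change (csum (S k) (t k) = poch (c - x) k * poch (c - y) k
            / (poch c k * RtoC (INR (fact k)))) in IH.
  (* A Zeilberger certificate for that recurrence. Telescoping stops at [j = k], where [k - j] is
     still a true difference; [g (S k)] then accounts for the last term [t (S k) (S k)]. *)
  set (g := fun j => - ((c + RtoC (INR j) - 1) * RtoC (INR j) * t (S k) j)).
  assert (T : csum (S k) (fun j => (RtoC (INR k) + 1) * (c + RtoC (INR k)) * t (S k) j
                 - (c - x + RtoC (INR k)) * (c - y + RtoC (INR k)) * t k j)
              = g (S k) - g O).
  { rewrite <- csum_telescope. apply csum_ext. intros j Hj. unfold g, t.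
    replace (S k - j)%nat with (S (k - j)) by lia.
    replace (S k - S j)%nat with (k - j)%nat by lia.
    assert (Ek : RtoC (INR k) = RtoC (INR j) + RtoC (INR (k - j)))
      by (rewrite <- RtoC_INR_add; do 2 f_equal; lia).
    rewrite Ek, !RtoC_INR_fact_S, RtoC_INR_S. simpl poch. unfold s.
    field. repeat split; auto using RtoC_INR_fact_neq_0, RtoC_INR_S_neq_0, poch_neq_0,
      nonpos_int_add_neq_0. }
  rewrite csum_minus, !csum_scal, IH in T.
  assert (Nk := RtoC_INR_S_neq_0 k). assert (Nc := nonpos_int_add_neq_0 c k Hc).
  assert (Np := poch_neq_0 c k Hc). assert (Nf := RtoC_INR_fact_neq_0 k).
  change (csum (S (S k)) (t (S k))) with (csum (S k) (t (S k)) + t (S k) (S k)).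
  assert (T' : (RtoC (INR k) + 1) * (c + RtoC (INR k)) * csum (S k) (t (S k))
     = (c - x + RtoC (INR k)) * (c - y + RtoC (INR k))
       * (poch (c - x) k * poch (c - y) k / (poch c k * RtoC (INR (fact k))))
       - (c + RtoC (INR k)) * (RtoC (INR k) + 1) * t (S k) (S k)).
  { replace ((RtoC (INR k) + 1) * (c + RtoC (INR k)) * csum (S k) (t (S k)))
      with (((RtoC (INR k) + 1) * (c + RtoC (INR k)) * csum (S k) (t (S k))
        - (c - x + RtoC (INR k)) * (c - y + RtoC (INR k))
       * (poch (c - x) k * poch (c - y) k / (poch c k * RtoC (INR (fact k)))))
       + (c - x + RtoC (INR k)) * (c - y + RtoC (INR k))
       * (poch (c - x) k * poch (c - y) k / (poch c k * RtoC (INR (fact k))))) by ring.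
    rewrite T. unfold g. rewrite RtoC_INR_S. simpl (INR 0). ring. }
  transitivity (((RtoC (INR k) + 1) * (c + RtoC (INR k)) * csum (S k) (t (S k))
     + (c + RtoC (INR k)) * (RtoC (INR k) + 1) * t (S k) (S k))
     / ((RtoC (INR k) + 1) * (c + RtoC (INR k)))); [now field|].
  rewrite T', RtoC_INR_fact_S. simpl poch. field. auto.
Qed.

Lemma hypF_euler (a b c : C) :
  ~ nonpos_int c -> hypF a b c = cpowR 2 (a + b - c) * hypF (c - a) (c - b) c.
Proof.
  intros Hc. rewrite <- binomial_series, Cmult_comm.
  apply cseries_unique.
  apply (has_sum_ext (fun k => csum (S k) (fun j =>
           hterm (c - a) (c - b) j / poch c j * bterm (a + b - c) (k - j)))).
  - intros k.
    transitivity ((/ 2) ^ k * csum (S k) (fun j => poch (c - a) j * poch (c - b) j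
        / (poch c j * RtoC (INR (fact j)))
        * (poch (c - (c - a) - (c - b)) (k - j) / RtoC (INR (fact (k - j)))))).
    + rewrite <- csum_scal. apply csum_ext. intros j Hj. unfold hterm, bterm.
      replace (c - (c - a) - (c - b)) with (a + b - c) by ring.
      replace ((/ 2) ^ k) with ((/ 2) ^ j * (/ 2) ^ (k - j))
        by (rewrite <- Cpow_add_r; f_equal; lia).
      field. repeat split; auto using poch_neq_0, RtoC_INR_fact_neq_0.
    + rewrite pfaff_saalschutz by assumption. unfold hterm.
      replace (c - (c - a)) with a by ring. replace (c - (c - b)) with b by ring.
      field. split; auto using poch_neq_0, RtoC_INR_fact_neq_0.
  - apply has_sum_cauchy_product; [now apply hypF_geo | apply bterm_geo].
Qed.

(** * Euler summation of alternating series *)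

Fixpoint iter_diff (a : nat -> C) (k m : nat) : C :=
  match k with
  | O => a m
  | S k' => iter_diff a k' m - iter_diff a k' (S m)
  end.

(** Converts an eventual bound into one for all [n] with an excess [M * (/ 2) ^ n], a form that
    averaging neighbours shrinks by a fixed factor. *)
Lemma eventually_le_geom (e : nat -> R) (d : R) (N : nat) :
  (0 <= d)%R -> (forall n, (N <= n)%nat -> (e n <= d)%R) ->
  exists M, (0 <= M)%R /\ forall n, (e n <= d + M * (/ 2) ^ n)%R.
Proof.
  intros Hd. revert e. induction N as [|N IH]; intros e H.
  - exists 0%R. split; [lra|]. intros n. specialize (H n ltac:(lia)). lra.
  - destruct (IH (fun n => e (S n))) as (M & HM & HM'); [intros n Hn; apply H; lia|].
    exists (Rmax (Rabs (e O)) (2 * M)). split.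
    + eapply Rle_trans; [apply Rabs_pos | apply Rmax_l].
    + intros [|n].
      * simpl. assert (A := Rmax_l (Rabs (e O)) (2 * M)). assert (B := Rle_abs (e O)). lra.
      * eapply Rle_trans; [apply HM'|].
        assert (A := Rmax_r (Rabs (e O)) (2 * M)).
        assert (P := pow_lt (/ 2) n ltac:(lra)). simpl. nra.
Qed.

Lemma euler_summation (a : nat -> C) (L : C) :
  has_sum (fun m => (-1) ^ m * a m) L ->
  has_sum (fun k => (/ 2) ^ S k * iter_diff a k 0) L.
Proof.
  intros H.
  (* The [n]-th partial sum plus [K] Euler terms for the remainder. Raising [K] averages the values
     at [n] and [n + 1], so [P K 0], the Euler partial sum, is a binomial mean of the original
     partial sums. *)
  set (P := fun K n => csum n (fun m => (-1) ^ m * a m)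
                       + (-1) ^ n * csum K (fun k => (/ 2) ^ S k * iter_diff a k n)).
  assert (P_S : forall K n, P (S K) n = / 2 * (P K n + P K (S n))).
  { intros K n. unfold P. rewrite csum_first.
    rewrite (csum_ext K (fun k => (/ 2) ^ S (S k) * iter_diff a (S k) n)
      (fun k => / 2 * ((/ 2) ^ S k * iter_diff a k n - (/ 2) ^ S k * iter_diff a k (S n))))
      by (intros k _; rewrite (Cpow_S _ (S k)); simpl iter_diff; ring).
    rewrite csum_scal, csum_minus.
    set (X := csum K (fun k => (/ 2) ^ S k * iter_diff a k n)).
    set (Y := csum K (fun k => (/ 2) ^ S k * iter_diff a k (S n))).
    simpl. field. }
  unfold has_sum in *. rewrite clim_eps in *. intros eps He.
  destruct (H (eps / 2)%R) as [N HN]; [lra|].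
  destruct (eventually_le_geom (fun n => Cmod (csum n (fun m => (-1) ^ m * a m) - L))
              (eps / 2) N) as (M & HM & HM'); [lra | intros n Hn; left; auto |].
  (* Averaging [(/ 2) ^ n] with [(/ 2) ^ S n] multiplies it by [(1 + 1/2) / 2 = 3/4]. *)
  assert (B : forall K n, (Cmod (P K n - L) <= eps / 2 + M * (3 / 4) ^ K * (/ 2) ^ n)%R).
  { induction K as [|K IH]; intros n.
    - unfold P. simpl csum at 2. replace ((-1) ^ n * 0) with (RtoC 0) by ring.
      rewrite Cplus_0_r. simpl pow at 1. rewrite Rmult_1_r. apply HM'.
    - rewrite P_S.
      replace (/ 2 * (P K n + P K (S n)) - L)
        with (/ 2 * ((P K n - L) + (P K (S n) - L))) by field.
      rewrite Cmod_mult, Cmod_inv, Cmod_R, Rabs_pos_eq by (apply two_neq_0 || lra).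
      assert (T := Cmod_triangle (P K n - L) (P K (S n) - L)).
      assert (A1 := IH n). assert (A2 := IH (S n)).
      simpl pow in *. lra. }
  assert (G := is_lim_seq_geom_scal M (3 / 4) ltac:(lra)).
  apply is_lim_seq_Reals in G. destruct (G (eps / 2)%R) as [K0 HK]; [lra|].
  exists K0. intros K HKK. specialize (HK K HKK). unfold Rdist in HK.
  rewrite Rminus_0_r in HK. assert (Q := Rle_abs (M * (3 / 4) ^ K)).
  specialize (B K O). unfold P in B.
  replace (csum 0 (fun m => (-1) ^ m * a m) + (-1) ^ 0 * csum K (fun k => (/ 2) ^ S k * iter_diff a k 0))
    with (csum K (fun k => (/ 2) ^ S k * iter_diff a k 0)) in B
    by (simpl; ring).
  rewrite pow_O, Rmult_1_r in B. lra.
Qed.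

(** Leibniz rule for differences of a product; a difference raises the first index of [W] and the
    second of [B]. The shift [m + j] comes from [w b - w' b' = (w - w') b + w' (b - b')]. *)
Lemma iter_diff_leibniz (W B : nat -> nat -> C) :
  (forall l m, W l m - W l (S m) = W (S l) m) ->
  (forall m k, B m k - B (S m) k = B m (S k)) ->
  forall k m, iter_diff (fun m => W O m * B m O) k m
    = csum (S k) (fun j => RtoC (pasc k j) * (W (k - j)%nat (m + j)%nat * B m j)).
Proof.
  intros HW HB. induction k as [|k IH]; intros m.
  - simpl. rewrite Nat.add_0_r. ring.
  - rewrite csum_pascal. simpl iter_diff. rewrite !IH, <- csum_minus.
    apply csum_ext. intros j Hj.
    replace (S k - j)%nat with (S (k - j)) by lia.
    replace (S k - S j)%nat with (k - j)%nat by lia.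
    rewrite <- HW, <- HB, Nat.add_succ_r. simpl. ring.
Qed.

(** * Reduction of the Appell series *)

Lemma clim_csum (M : nat) (u : nat -> nat -> C) (l : nat -> C) :
  (forall m, clim (u m) (l m)) -> clim (fun N => csum M (fun m => u m N)) (csum M l).
Proof.
  intros H. induction M as [|M IH]; [apply clim_const | now apply clim_plus].
Qed.

(** Fix [M >= K] and let [N] tend to infinity in the rectangle estimate. The limit only preserves a
    weak inequality, hence [eps / 2]. *)
Lemma pringsheim_iterated (t : nat -> nat -> C) (R : nat -> C) (L : C) :
  (forall m, has_sum (t m) (R m)) -> double_series_converges_to t L -> has_sum R L.
Proof.
  intros HR HL. apply clim_eps. intros eps He.
  destruct (HL (eps / 2)%R) as [K HK]; [lra|].
  exists K. intros M HM.
  apply Rle_lt_trans with (eps / 2)%R; [|lra].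
  apply (Cmod_lim_le _ _ L (eps / 2) K (clim_csum M (fun m N => csum N (t m)) R HR)).
  intros N HN. left. now apply HK.
Qed.

(** The [l]-th difference of [(al)_m / m!]. It is the case [be = 1], [eps = al] of [beta_weight], as
    [(1)_n = n!]. *)
Definition fact_weight (al : C) (l m : nat) : C :=
  poch (1 - al) l * poch al m / RtoC (INR (fact (m + l))).

(** Formally the integral of [t^m (1 - t)^N] against the Beta density with parameters [eps] and
    [be - eps]; [beta_weight_diff] is then [t^m - t^(m+1) = t^m (1 - t)]. *)
Definition beta_weight (be eps : C) (m N : nat) : C :=
  poch eps m * poch (be - eps) N / poch be (m + N).

(** The inner sum of the Appell series without its [alpha] factor, after [k] differences in [m]. *)
Definition beta_row (be eps ga : C) (m k : nat) : C :=
  cseries (fun n => bterm ga n * beta_weight be eps m (n + k)).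

Lemma fact_weight_diff (al : C) (l m : nat) :
  fact_weight al l m - fact_weight al l (S m) = fact_weight al (S l) m.
Proof.
  unfold fact_weight. replace (S m + l)%nat with (S (m + l)) by lia.
  replace (m + S l)%nat with (S (m + l)) by lia.
  rewrite RtoC_INR_fact_S, RtoC_INR_add. simpl poch.
  assert (N := RtoC_INR_S_neq_0 (m + l)). rewrite RtoC_INR_add in N.
  field. split; auto using RtoC_INR_fact_neq_0.
Qed.

Lemma beta_weight_diff (be eps : C) (m N : nat) :
  ~ nonpos_int be ->
  beta_weight be eps m N - beta_weight be eps (S m) N = beta_weight be eps m (S N).
Proof.
  intros be_ord. unfold beta_weight. replace (S m + N)%nat with (S (m + N)) by lia.
  replace (m + S N)%nat with (S (m + N)) by lia. simpl poch.
  assert (H := nonpos_int_add_neq_0 be (m + N) be_ord). rewrite RtoC_INR_add in *.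
  field. split; auto using poch_neq_0.
Qed.

Lemma beta_weight_bound (be eps : C) (m : nat) :
  ~ nonpos_int be ->
  exists M, (0 <= M)%R /\ forall N, (Cmod (beta_weight be eps m N) <= M * (5 / 4) ^ N)%R.
Proof.
  intros be_ord.
  destruct (poch_ratio_bound (be - eps) (be + RtoC (INR m)) (nonpos_int_shift be m be_ord))
    as (M & HM & H).
  exists (Cmod (poch eps m / poch be m) * M)%R.
  split; [apply Rmult_le_pos; auto using Cmod_ge_0|]. intros N.
  unfold beta_weight. rewrite poch_add.
  replace (poch eps m * poch (be - eps) N / (poch be m * poch (be + RtoC (INR m)) N))
    with (poch eps m / poch be m * (poch (be - eps) N / poch (be + RtoC (INR m)) N))
    by (field; split; auto using poch_neq_0, nonpos_int_shift).
  rewrite Cmod_mult, Rmult_assoc. apply Rmult_le_compat_l; auto using Cmod_ge_0.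
Qed.

Lemma beta_row_term_bound (be eps ga : C) (m : nat) :
  ~ nonpos_int be ->
  exists M, (0 <= M)%R /\
    forall k n, (Cmod (bterm ga n * beta_weight be eps m (n + k))
                 <= M * (5 / 4) ^ k * (25 / 32) ^ n)%R.
Proof.
  intros be_ord.
  destruct (bterm_bound ga) as (M1 & P1 & H1). destruct (beta_weight_bound be eps m be_ord) as (M2 & P2 & H2).
  exists (M1 * M2)%R. split; [now apply Rmult_le_pos|]. intros k n.
  rewrite Cmod_mult.
  replace (25 / 32)%R with (5 / 8 * (5 / 4))%R by lra. rewrite Rpow_mult_distr.
  replace (M1 * M2 * (5 / 4) ^ k * ((5 / 8) ^ n * (5 / 4) ^ n))%R
    with ((M1 * (5 / 8) ^ n) * (M2 * (5 / 4) ^ (n + k)))%R by (rewrite pow_add; ring).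
  apply Rmult_le_compat; auto using Cmod_ge_0.
Qed.

Lemma beta_row_has_sum (be eps ga : C) (m k : nat) :
  ~ nonpos_int be ->
  has_sum (fun n => bterm ga n * beta_weight be eps m (n + k)) (beta_row be eps ga m k).
Proof.
  intros be_ord.
  apply geo_has_sum. destruct (beta_row_term_bound be eps ga m be_ord) as (M & HM & H).
  exists (M * (5 / 4) ^ k)%R, (25 / 32)%R. repeat split; auto; try lra.
  apply Rmult_le_pos; auto. apply pow_le. lra.
Qed.

Lemma beta_row_diff (be eps ga : C) (m k : nat) :
  ~ nonpos_int be ->
  beta_row be eps ga m k - beta_row be eps ga (S m) k = beta_row be eps ga m (S k).
Proof.
  intros be_ord.
  apply clim_unique with (fun N => csum N (fun n => bterm ga n * beta_weight be eps m (n + S k))).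
  - apply (has_sum_ext (fun n => bterm ga n * beta_weight be eps m (n + k)
                                 - bterm ga n * beta_weight be eps (S m) (n + k))).
    + intros n. rewrite Nat.add_succ_r, <- beta_weight_diff by exact be_ord. ring.
    + apply has_sum_minus; now apply beta_row_has_sum.
  - now apply beta_row_has_sum.
Qed.

(** At [m = 0] the weight depends only on [n + j], so on each diagonal it factors out and the
    binomial terms convolve to [bterm (al + ga)]. *)
Lemma beta_row_series (al be eps ga : C) :
  ~ nonpos_int be ->
  cseries (fun j => bterm al j * beta_row be eps ga 0 j) = hypF (be - eps) (al + ga) be.
Proof.
  intros be_ord.
  destruct (bterm_bound al) as (M1 & P1 & H1).
  destruct (beta_row_term_bound be eps ga 0 be_ord) as (M2 & P2 & H2).
  rewrite (cseries_ext _ (fun j => cseries (fun n => bterm al j * (bterm ga n * beta_weight be eps 0 (n + j))))).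
  2:{ intros j. symmetry. now apply cseries_unique, has_sum_scal, beta_row_has_sum. }
  symmetry. apply cseries_unique.
  apply (has_sum_ext (fun k => csum (S k) (fun j =>
           bterm al j * (bterm ga (k - j) * beta_weight be eps 0 (k - j + j))))).
  - intros k.
    rewrite (csum_ext (S k) _ (fun j => beta_weight be eps 0 k * (bterm al j * bterm ga (k - j)))).
    + rewrite csum_scal, bterm_convolution. unfold beta_weight, hterm, bterm. simpl.
      field. split; auto using poch_neq_0, RtoC_INR_fact_neq_0.
    + intros j Hj. replace (k - j + j)%nat with k by lia. ring.
  - apply (has_sum_diagonal (fun j n => bterm al j * (bterm ga n * beta_weight be eps 0 (n + j)))
             (M1 * M2) (25 / 32)); [now apply Rmult_le_pos | lra |].
    intros j n. rewrite Cmod_mult.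
    replace (M1 * M2 * (25 / 32) ^ (j + n))%R
      with ((M1 * (5 / 8) ^ j) * (M2 * (5 / 4) ^ j * (25 / 32) ^ n))%R.
    + apply Rmult_le_compat; auto using Cmod_ge_0.
    + rewrite pow_add. replace (25 / 32)%R with (5 / 8 * (5 / 4))%R at 2 by lra.
      rewrite (Rpow_mult_distr (5 / 8) (5 / 4) j). ring.
Qed.

Lemma F3_reduction (al be eps ga L : C) :
  ~ nonpos_int be ->
  double_series_converges_to
    (F3_term al eps (be - eps) ga be (RtoC (-1)) (RtoC (1 / 2))) L ->
  L = cpowR 2 (- al) * hypF (be - eps) (al + ga) be.
Proof.
  intros be_ord HL.
  assert (Hrow : forall m, has_sum
    (F3_term al eps (be - eps) ga be (RtoC (-1)) (RtoC (1 / 2)) m)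
    ((-1) ^ m * (fact_weight al 0 m * beta_row be eps ga m 0))).
  { intros m.
    apply (has_sum_ext (fun n => ((-1) ^ m * fact_weight al 0 m) * (bterm ga n * beta_weight be eps m (n + 0)))).
    - intros n. unfold F3_term, fact_weight, beta_weight, bterm. rewrite !Nat.add_0_r. simpl (poch _ 0).
      replace (RtoC (1 / 2)) with (/ 2) by (rewrite RtoC_div by lra; field).
      field. repeat split; auto using poch_neq_0, RtoC_INR_fact_neq_0.
    - rewrite Cmult_assoc. now apply has_sum_scal, beta_row_has_sum. }
  assert (HS := pringsheim_iterated _ _ _ Hrow HL).
  apply (euler_summation (fun m => fact_weight al 0 m * beta_row be eps ga m 0)) in HS.
  (* The rows grow at most like [(5/4)^j], while [bterm al j] decays like [(5/8)^j]. *)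
  assert (Gf : geo (fun j => bterm al j * beta_row be eps ga 0 j)).
  { destruct (bterm_bound al) as (M1 & P1 & H1).
    destruct (beta_row_term_bound be eps ga 0 be_ord) as (M2 & P2 & H2).
    exists (M1 * (M2 / (1 - 25 / 32)))%R, (25 / 32)%R. repeat split; try lra.
    - apply Rmult_le_pos; auto. apply Rmult_le_pos; auto. left. apply Rinv_0_lt_compat; lra.
    - intros j. rewrite Cmod_mult.
      replace (M1 * (M2 / (1 - 25 / 32)) * (25 / 32) ^ j)%R
        with ((M1 * (5 / 8) ^ j) * (M2 * (5 / 4) ^ j / (1 - 25 / 32)))%R.
      + apply Rmult_le_compat; auto using Cmod_ge_0.
        apply geo_cseries_le; auto; [|lra].
        apply Rmult_le_pos; auto. apply pow_le; lra.
      + replace (25 / 32)%R with (5 / 8 * (5 / 4))%R at 3 by lra.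
        rewrite (Rpow_mult_distr (5 / 8) (5 / 4) j). field. }
  assert (HP := has_sum_scal (/ 2) _ _ (has_sum_cauchy_product _ _ Gf (bterm_geo (1 - al)))).
  rewrite beta_row_series, binomial_series in HP by exact be_ord.
  rewrite (clim_unique _ L (/ 2 * (hypF (be - eps) (al + ga) be * cpowR 2 (1 - al))) HS).
  - unfold Cminus. rewrite cpowR_plus, cpowR_1 by lra. field.
  - apply (has_sum_ext _ _ _) with (2 := HP). intros k.
    rewrite (iter_diff_leibniz (fact_weight al) (beta_row be eps ga) (fact_weight_diff al)
               (fun m k => beta_row_diff be eps ga m k be_ord)).
    rewrite <- !csum_scal. apply csum_ext. intros j Hj.
    unfold fact_weight, bterm. simpl (0 + j)%nat.
    replace (j + (k - j))%nat with k by lia.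
    (* The binomial coefficient replaces the [k!] of [fact_weight] by [j! (k - j)!], which separates
       the term into a Cauchy product. *)
    rewrite pasc_fact, Cpow_S by lia.
    replace ((/ 2) ^ k) with ((/ 2) ^ j * (/ 2) ^ (k - j))
      by (rewrite <- Cpow_add_r; f_equal; lia).
    field. repeat split; apply RtoC_INR_fact_neq_0.
Qed.

(** * Generalized Kummer summations *)

Lemma regF_kummer_minus (q b : C) (i : nat) :
  ~ nonpos_int (1 - q) -> ~ nonpos_int b ->
  (forall r, (r <= i)%nat -> ~ nonpos_int ((b + RtoC (INR r)) / 2)) ->
  regF q (1 - q + RtoC (INR i)) (b + (1 - q + RtoC (INR i)))
  = cpowR 2 (q - 1) * rGamma b * rGamma (1 - q + RtoC (INR i)) / rGamma (1 - q)
    * csum (S i) (fun r => RtoC ((-1) ^ r * Binomial.C i r)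
        * Gamma ((b + RtoC (INR r)) / 2) * rGamma ((b + RtoC (INR r)) / 2 + 1 - q)).
Proof.
  intros Hq Hb Hr.
  set (e := fun k => 1 - q + RtoC (INR k)).
  (* In [regF_contiguous_E] the difference [c - E] equals [b + r] here; dividing by these two
     factors makes the coefficients 1 and -1. Row [k = 0] falls under Bailey's theorem. *)
  set (Y := fun k r => regF q (e k) (b + RtoC (INR r) + e k) / (rGamma (e k) * rGamma (b + RtoC (INR r)))).
  assert (Ne : forall k, rGamma (e k) <> 0) by (intros k; now apply rGamma_neq_0, nonpos_int_shift).
  assert (Nb : forall r, rGamma (b + RtoC (INR r)) <> 0)
    by (intros r; now apply rGamma_neq_0, nonpos_int_shift).
  assert (Nq := rGamma_neq_0 _ Hq).
  assert (YS : forall k r, Y (S k) r = Y k r + (-1) * Y k (S r)).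
  { intros k r. unfold Y.
    assert (Ee : e (S k) = e k + 1) by (unfold e; rewrite RtoC_INR_S; ring).
    assert (Ne' := Ne (S k)). assert (Nb' := Nb (S r)).
    rewrite Ee in *. rewrite RtoC_INR_S in *.
    replace (b + (RtoC (INR r) + 1)) with (b + RtoC (INR r) + 1) in * by ring.
    set (c := b + RtoC (INR r) + e k).
    replace (b + RtoC (INR r) + (e k + 1)) with (c + 1) by (unfold c; ring).
    replace (b + RtoC (INR r) + 1 + e k) with (c + 1) by (unfold c; ring).
    assert (C1 := regF_contiguous_E q (e k) c).
    replace (c - e k) with (b + RtoC (INR r)) in C1 by (unfold c; ring).
    assert (Nek := Ne k). assert (Nbr := Nb r).
    rewrite (rGamma_succ (e k)) in *. rewrite (rGamma_succ (b + RtoC (INR r))) in *.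
    assert (N1 : e k <> 0) by (now apply nonpos_int_neq_0, nonpos_int_shift).
    assert (N2 : b + RtoC (INR r) <> 0) by (now apply nonpos_int_add_neq_0).
    transitivity (e k * regF q (e k + 1) (c + 1)
       / (e k * rGamma (e k + 1) * ((b + RtoC (INR r)) * rGamma (b + RtoC (INR r) + 1)))); [field; auto|].
    rewrite C1. field. auto. }
  assert (T := binomial_table (-1) Y i 0 (fun k r _ => YS k r)).
  assert (Y0 : forall r, (r <= i)%nat -> Y O r = cpowR 2 (q - 1) / rGamma (1 - q)
      * (Gamma ((b + RtoC (INR r)) / 2) * rGamma ((b + RtoC (INR r)) / 2 + 1 - q))).
  { intros r Hri. unfold Y. replace (e O) with (1 - q) by (unfold e; simpl; ring).
    set (c := b + RtoC (INR r) + (1 - q)).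
    assert (Ec : c + q - 1 = b + RtoC (INR r)) by (unfold c; ring).
    rewrite regF_bailey_Gamma; rewrite Ec; [|now apply Hr].
    replace ((c + 1 - q) / 2) with ((b + RtoC (INR r)) / 2 + 1 - q) by (unfold c; field).
    field. auto. }
  assert (E1 : Y i O = regF q (e i) (b + e i) / (rGamma (e i) * rGamma b)).
  { unfold Y. simpl (INR 0). now rewrite Cplus_0_r. }
  assert (Nb0 : rGamma b <> 0) by (now apply rGamma_neq_0).
  fold (e i).
  transitivity (Y i O * (rGamma (e i) * rGamma b)); [rewrite E1; field; auto|].
  rewrite T.
  rewrite (csum_ext (S i) _ (fun r => cpowR 2 (q - 1) / rGamma (1 - q) *
    (RtoC ((-1) ^ r * Binomial.C i r)
        * Gamma ((b + RtoC (INR r)) / 2) * rGamma ((b + RtoC (INR r)) / 2 + 1 - q)))).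
  - rewrite csum_scal. field. auto.
  - intros r Hri. simpl (0 + r)%nat. rewrite Y0, pasc_binomial, RtoC_mult, RtoC_pow by lia.
    field. auto.
Qed.

Lemma regF_kummer_plus (q b : C) (i : nat) :
  ~ nonpos_int b ->
  (forall r, (r <= i)%nat -> ~ nonpos_int ((b + RtoC (INR r)) / 2)) ->
  regF q (1 - q - RtoC (INR i)) (b + (1 - q - RtoC (INR i)))
  = cpowR 2 (q - 1) * rGamma b
    * csum (S i) (fun r => RtoC (Binomial.C i r)
        * Gamma ((b + RtoC (INR r)) / 2)
        * rGamma ((b + RtoC (INR r)) / 2 + 1 - q - RtoC (INR i))).
Proof.
  intros Hb Hr.
  (* The second parameter becomes [1 - a], so Bailey's theorem applies with first parameter [a], and
     [i] contiguity steps lower [a] to [q]. *)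
  set (a := q + RtoC (INR i)).
  replace (1 - q - RtoC (INR i)) with (1 - a) by (unfold a; ring).
  (* The factor [2 ^ k] absorbs the 2 in [regF_contiguous_q], and the division turns its coefficient
     [b + r] into 1. At the end [2^(a - 1) / 2^i] is [2^(q - 1)]. *)
  set (U := fun k r => 2 ^ k * regF (a - RtoC (INR k)) (1 - a) (b + RtoC (INR r) + (1 - a))
                       / rGamma (b + RtoC (INR r))).
  assert (Nb : forall r, rGamma (b + RtoC (INR r)) <> 0)
    by (intros r; now apply rGamma_neq_0, nonpos_int_shift).
  assert (US : forall k r, U (S k) r = U k r + 1 * U k (S r)).
  { intros k r. unfold U. rewrite !RtoC_INR_S.
    assert (Nb' := Nb (S r)). rewrite RtoC_INR_S in Nb'.
    replace (b + (RtoC (INR r) + 1)) with (b + RtoC (INR r) + 1) in * by ring.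
    set (c := b + RtoC (INR r) + (1 - a)).
    replace (b + RtoC (INR r) + 1 + (1 - a)) with (c + 1) by (unfold c; ring).
    assert (C1 := regF_contiguous_q (a - (RtoC (INR k) + 1)) (1 - a) c).
    replace (a - (RtoC (INR k) + 1) + 1) with (a - RtoC (INR k)) in C1 by ring.
    replace (c - (1 - a)) with (b + RtoC (INR r)) in C1 by (unfold c; ring).
    assert (Nbr := Nb r).
    rewrite (rGamma_succ (b + RtoC (INR r))) in *.
    assert (N2 : b + RtoC (INR r) <> 0) by (now apply nonpos_int_add_neq_0).
    rewrite Cpow_S.
    transitivity (2 ^ k * (2 * regF (a - (RtoC (INR k) + 1)) (1 - a) c)
       / ((b + RtoC (INR r)) * rGamma (b + RtoC (INR r) + 1))); [field; auto|].
    rewrite C1. field. auto. }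
  assert (T := binomial_table 1 U i 0 (fun k r _ => US k r)).
  assert (U0 : forall r, (r <= i)%nat -> U O r = cpowR 2 (a - 1)
      * (Gamma ((b + RtoC (INR r)) / 2) * rGamma ((b + RtoC (INR r)) / 2 + 1 - a))).
  { intros r Hri. unfold U. simpl (INR 0). replace (a - 0) with a by ring.
    set (c := b + RtoC (INR r) + (1 - a)).
    assert (Ec : c + a - 1 = b + RtoC (INR r)) by (unfold c; ring).
    rewrite regF_bailey_Gamma; rewrite Ec; [|now apply Hr].
    replace ((c + 1 - a) / 2) with ((b + RtoC (INR r)) / 2 + 1 - a) by (unfold c; field).
    simpl (2 ^ 0). field. auto. }
  assert (P2 : forall k, cpowR 2 (RtoC (INR k)) = 2 ^ k).
  { induction k as [|k IH]; [simpl; apply cpowR_0|].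
    rewrite RtoC_INR_S, cpowR_plus, IH, cpowR_1, Cpow_S by lra. ring. }
  assert (Nb0 : rGamma b <> 0) by (now apply rGamma_neq_0).
  assert (N2 : (2 : C) ^ i <> 0) by (apply Cpow_nz, two_neq_0).
  assert (E1 : U i O = 2 ^ i * regF q (1 - a) (b + (1 - a)) / rGamma b).
  { unfold U. simpl (INR 0). rewrite Cplus_0_r.
    now replace (a - RtoC (INR i)) with q by (unfold a; ring). }
  transitivity (U i O * rGamma b / 2 ^ i); [rewrite E1; field; auto|].
  rewrite T.
  rewrite (csum_ext (S i) _ (fun r => cpowR 2 (a - 1) *
    (RtoC (Binomial.C i r)
        * Gamma ((b + RtoC (INR r)) / 2)
        * rGamma ((b + RtoC (INR r)) / 2 + 1 - q - RtoC (INR i))))).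
  - rewrite csum_scal.
    replace (a - 1) with ((q - 1) + RtoC (INR i)) by (unfold a; ring).
    rewrite cpowR_plus, P2. field. auto.
  - intros r Hri. simpl (0 + r)%nat. rewrite U0, pasc_binomial, Cpow_1_l by lia.
    replace ((b + RtoC (INR r)) / 2 + 1 - a)
      with ((b + RtoC (INR r)) / 2 + 1 - q - RtoC (INR i)) by (unfold a; ring).
    ring.
Qed.

Theorem theorem9 (i : nat) (alpha beta eps : C) :
  (* first identity *)
  ( ~ nonpos_int beta ->
    ~ nonpos_int (1 - eps) ->
    ~ nonpos_int (1 - eps + RtoC (INR i)) ->
    ~ nonpos_int (beta + eps - RtoC (INR i) - 1) ->
    (forall r : nat, (r <= i)%nat ->
       ~ nonpos_int ((beta + eps - RtoC (INR i) + RtoC (INR r) - 1) / 2) /\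
       ~ nonpos_int ((beta - eps - RtoC (INR i) + RtoC (INR r) + 1) / 2)) ->
    forall L : C,
      double_series_converges_to
        (F3_term alpha eps (beta - eps) (beta + eps - alpha - RtoC (INR i) - 1)
                 beta (RtoC (-1)) (RtoC (1/2)))
        L ->
      L = cpowR 2 (beta + eps - alpha - RtoC (INR i) - 2) * Gamma (1 - eps) * Gamma beta
          / (Gamma (1 - eps + RtoC (INR i)) * Gamma (beta + eps - RtoC (INR i) - 1))
          * csum (S i) (fun r =>
              RtoC ((-1) ^ r * Binomial.C i r)
              * Gamma ((beta + eps - RtoC (INR i) + RtoC (INR r) - 1) / 2)
              / Gamma ((beta - eps - RtoC (INR i) + RtoC (INR r) + 1) / 2)) )
  /\
  (* second identity *)
  ( ~ nonpos_int beta ->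
    ~ nonpos_int (beta + eps + RtoC (INR i) - 1) ->
    (forall r : nat, (r <= i)%nat ->
       ~ nonpos_int ((beta + eps + RtoC (INR i) + RtoC (INR r) - 1) / 2) /\
       ~ nonpos_int ((beta - eps - RtoC (INR i) + RtoC (INR r) + 1) / 2)) ->
    forall L : C,
      double_series_converges_to
        (F3_term alpha eps (beta - eps) (beta + eps - alpha + RtoC (INR i) - 1)
                 beta (RtoC (-1)) (RtoC (1/2)))
        L ->
      L = cpowR 2 (beta + eps - alpha + RtoC (INR i) - 2) * Gamma beta
          / Gamma (beta + eps + RtoC (INR i) - 1)
          * csum (S i) (fun r =>
              RtoC (Binomial.C i r)
              * Gamma ((beta + eps + RtoC (INR i) + RtoC (INR r) - 1) / 2)
              / Gamma ((beta - eps - RtoC (INR i) + RtoC (INR r) + 1) / 2)) ).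
Proof.
  split.
  - intros Hbeta Heps Hepsi Hb Hr L HL.
    (* [b] is [beta] minus the second upper parameter [1 - eps + i] left by Euler's transformation,
       as the Kummer sum requires. *)
    set (b := beta + eps - RtoC (INR i) - 1) in *.
    rewrite (F3_reduction alpha beta eps _ L Hbeta HL), (hypF_euler _ _ beta Hbeta).
    replace (beta - (beta - eps)) with eps by ring.
    replace (beta - (alpha + (beta + eps - alpha - RtoC (INR i) - 1)))
      with (1 - eps + RtoC (INR i)) by ring.
    assert (Nbeta := rGamma_neq_0 _ Hbeta). assert (Nb := rGamma_neq_0 _ Hb).
    assert (Neps := rGamma_neq_0 _ Heps). assert (Nepsi := rGamma_neq_0 _ Hepsi).
    assert (Er : forall r, (beta + eps - RtoC (INR i) + RtoC (INR r) - 1) / 2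
                           = (b + RtoC (INR r)) / 2) by (intros r; unfold b; field).
    assert (K := regF_kummer_minus eps b i Heps Hb).
    replace (b + (1 - eps + RtoC (INR i))) with beta in K by (unfold b; ring).
    rewrite (regF_hypF _ _ beta Hbeta) in K.
    assert (Hr1 : forall r, (r <= i)%nat -> ~ nonpos_int ((b + RtoC (INR r)) / 2))
      by (intros r Hri; rewrite <- Er; now apply Hr).
    specialize (K Hr1).
    rewrite (Gamma_rGamma _ Hbeta), (Gamma_rGamma _ Heps), (Gamma_rGamma _ Hepsi), (Gamma_rGamma _ Hb).
    rewrite (csum_ext (S i) (fun r => RtoC ((-1) ^ r * Binomial.C i r)
              * Gamma ((beta + eps - RtoC (INR i) + RtoC (INR r) - 1) / 2)
              / Gamma ((beta - eps - RtoC (INR i) + RtoC (INR r) + 1) / 2))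
       (fun r => RtoC ((-1) ^ r * Binomial.C i r)
        * Gamma ((b + RtoC (INR r)) / 2) * rGamma ((b + RtoC (INR r)) / 2 + 1 - eps))).
    2:{ intros r Hri. destruct (Hr r ltac:(lia)) as [_ H2].
        rewrite (Gamma_rGamma _ H2), Er.
        replace ((beta - eps - RtoC (INR i) + RtoC (INR r) + 1) / 2)
          with ((b + RtoC (INR r)) / 2 + 1 - eps) in * by (unfold b; field).
        assert (N2 := rGamma_neq_0 _ H2). now field. }
    set (Sm := csum (S i) _) in *.
    (* The three powers of 2 come from Euler summation, Euler's transformation and Bailey's theorem,
       in this order. *)
    assert (P : cpowR 2 (beta + eps - alpha - RtoC (INR i) - 2)
                = cpowR 2 (- alpha)
                  * cpowR 2 (beta - eps + (alpha + (beta + eps - alpha - RtoC (INR i) - 1)) - beta)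
                  * cpowR 2 (eps - 1)).
    { rewrite <- !cpowR_plus. f_equal. ring. }
    rewrite P.
    transitivity (cpowR 2 (- alpha)
       * cpowR 2 (beta - eps + (alpha + (beta + eps - alpha - RtoC (INR i) - 1)) - beta)
       * (rGamma beta * hypF eps (1 - eps + RtoC (INR i)) beta) / rGamma beta); [now field|].
    rewrite K. field. auto.
  - intros Hbeta Hb Hr L HL.
    set (b := beta + eps + RtoC (INR i) - 1) in *.
    rewrite (F3_reduction alpha beta eps _ L Hbeta HL), (hypF_euler _ _ beta Hbeta).
    replace (beta - (beta - eps)) with eps by ring.
    replace (beta - (alpha + (beta + eps - alpha + RtoC (INR i) - 1)))
      with (1 - eps - RtoC (INR i)) by ring.
    assert (Nbeta := rGamma_neq_0 _ Hbeta). assert (Nb := rGamma_neq_0 _ Hb).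
    assert (Er : forall r, (beta + eps + RtoC (INR i) + RtoC (INR r) - 1) / 2
                           = (b + RtoC (INR r)) / 2) by (intros r; unfold b; field).
    assert (K := regF_kummer_plus eps b i Hb).
    replace (b + (1 - eps - RtoC (INR i))) with beta in K by (unfold b; ring).
    rewrite (regF_hypF _ _ beta Hbeta) in K.
    assert (Hr1 : forall r, (r <= i)%nat -> ~ nonpos_int ((b + RtoC (INR r)) / 2))
      by (intros r Hri; rewrite <- Er; now apply Hr).
    specialize (K Hr1).
    rewrite (Gamma_rGamma _ Hbeta), (Gamma_rGamma _ Hb).
    rewrite (csum_ext (S i) (fun r => RtoC (Binomial.C i r)
              * Gamma ((beta + eps + RtoC (INR i) + RtoC (INR r) - 1) / 2)
              / Gamma ((beta - eps - RtoC (INR i) + RtoC (INR r) + 1) / 2))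
       (fun r => RtoC (Binomial.C i r) * Gamma ((b + RtoC (INR r)) / 2)
        * rGamma ((b + RtoC (INR r)) / 2 + 1 - eps - RtoC (INR i)))).
    2:{ intros r Hri. destruct (Hr r ltac:(lia)) as [_ H2].
        rewrite (Gamma_rGamma _ H2), Er.
        replace ((beta - eps - RtoC (INR i) + RtoC (INR r) + 1) / 2)
          with ((b + RtoC (INR r)) / 2 + 1 - eps - RtoC (INR i)) in * by (unfold b; field).
        assert (N2 := rGamma_neq_0 _ H2). now field. }
    set (Sm := csum (S i) _) in *.
    assert (P : cpowR 2 (beta + eps - alpha + RtoC (INR i) - 2)
                = cpowR 2 (- alpha)
                  * cpowR 2 (beta - eps + (alpha + (beta + eps - alpha + RtoC (INR i) - 1)) - beta)
                  * cpowR 2 (eps - 1)).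
    { rewrite <- !cpowR_plus. f_equal. ring. }
    rewrite P.
    transitivity (cpowR 2 (- alpha)
       * cpowR 2 (beta - eps + (alpha + (beta + eps - alpha + RtoC (INR i) - 1)) - beta)
       * (rGamma beta * hypF eps (1 - eps - RtoC (INR i)) beta) / rGamma beta); [now field|].
    rewrite K. field. auto.
Qed.
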